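(* Under the standing Assumption 1 of the context, let $\widetilde{\Xi}$ and $\Xi$ be the functions defined in the context and consider any $\overline{\omega}=(\overline{x},\overline{x},\overline{z})\in(\partial\widetilde{\Xi})^{-1}(0)$. Suppose that $F'$ and $G'$ are continuously differentiable on a neighborhood of $\overline{x}$, that the function $$f(y,s,u,z):=\vartheta_1(y)+h(s)+\langle u,z\rangle+\vartheta_2^*(-z)\quad\text{for }(y,s,u,z)\in\mathbb{Y}\times\mathbb{X}\times\mathbb{Z}\times\mathbb{Z}$$ satisfies the KL property of exponent $p\in[0,1)$ at $(\overline{y},\overline{x},\overline{u},\overline{z})$ with $\overline{y}=F(\overline{x})$ and $\overline{u}=G(\overline{x})$, and that $$\mathrm{Ker}\,[\nabla F(\overline{x})\ \ \mathcal{I}\ \ \nabla G(\overline{x})]\cap\Big[\limsup_{y\to\overline{y}}\mathrm{pos}(\partial\vartheta_1(y))\times\limsup_{x\xrightarrow[h]{}\overline{x}}\mathrm{pos}(\partial h(x))\times\limsup_{\zeta\to\overline{u}}\mathrm{pos}(-\partial\vartheta_2(\zeta))\Big]=\{(0,0,0)\}.$$ Then $\widetilde{\Xi}$ satisfies the KL property of exponent $p$ at $\overline{\omega}$; and, if $p\in[1/2,1)$, so does $\Xi$ at $(\overline{\omega},\overline{\mathcal{Q}})$ for any positive definite linear mapping $\overline{\mathcal{Q}}:\mathbb{X}\to\mathbb{X}$.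
   Context: **Setting.** $\mathbb{X},\mathbb{Y},\mathbb{Z}$ are Euclidean spaces; $F:\mathbb{X}\to\mathbb{Y}$, $G:\mathbb{X}\to\mathbb{Z}$, $\vartheta_1:\mathbb{Y}\to\mathbb{R}$, $\vartheta_2:\mathbb{Z}\to\mathbb{R}$, $h:\mathbb{X}\to\overline{\mathbb{R}}=(-\infty,\infty]$. **Assumption 1.** (i) $F,G$ are differentiable on an open set $\mathcal{O}\supset\mathrm{dom}\,h$ and $F',G'$ are strictly continuous (locally Lipschitz at each point) on $\mathcal{O}$; (ii) $\vartheta_1,\vartheta_2$ are convex and the conjugate $\vartheta_1^*$ is continuous relative to $\mathrm{dom}\,\vartheta_1^*$; (iii) $h$ is proper, lsc, convex, continuous relative to $\mathrm{dom}\,h\neq\emptyset$, and $h^*$ is continuous relative to $\mathrm{dom}\,h^*$; (iv) $\Phi:=\vartheta_1\circ F-\vartheta_2\circ G+h$ is bounded from below. **Notation.** $\nabla F(x)$ is the adjoint of $F'(x)$ (same for $G$); $\ell_F(x,s)=F(s)+F'(s)(x-s)$, $\ell_G(x,s)=G(s)+G'(s)(x-s)$; $\partial$ is the limiting subdifferential; $\|v\|_{\mathcal{Q}}^2=\langle v,\mathcal{Q}v\rangle$; $\mathbb{S}_+$ is the set of self-adjoint positive semidefinite linear maps on $\mathbb{X}$ (positive definite maps are self-adjoint by convention); $\chi_C$ is the indicator function of $C$. For $x\in\mathbb{X}$, $s\in\mathcal{O}$, $z\in\mathbb{Z}$ and self-adjoint $\mathcal{Q}$, $$\widetilde{\Xi}(x,s,z):=\vartheta_1(\ell_F(x,s))+\langle\ell_G(x,s),z\rangle+h(x)+\vartheta_2^*(-z),$$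 $$\Xi(x,s,z,\mathcal{Q}):=\widetilde{\Xi}(x,s,z)+\|x-s\|_{\mathcal{Q}}^2+\chi_{\mathbb{S}_+}(\mathcal{Q}).$$ $\mathrm{Ker}[\nabla F(\overline{x})\ \mathcal{I}\ \nabla G(\overline{x})]=\{(v,\xi,z)\in\mathbb{Y}\times\mathbb{X}\times\mathbb{Z}\mid\nabla F(\overline{x})v+\xi+\nabla G(\overline{x})z=0\}$. $\mathrm{pos}(C)=\{\lambda x\mid x\in C,\lambda\ge0\}$. $\limsup$ of a set-valued map is the Painlevé–Kuratowski outer limit; $x\xrightarrow[h]{}\overline{x}$ means $x\to\overline{x}$ with $h(x)\to h(\overline{x})$. **KL property of exponent $p$.** A proper lsc function $g$ has the KL property of exponent $p\in[0,1)$ at $\overline{x}\in\mathrm{dom}\,\partial g$ if there are $c>0$, $\eta\in(0,\infty]$ and a neighborhood $\mathcal{U}$ of $\overline{x}$ such that, with $\varphi(t)=ct^{1-p}$, $\varphi'(g(x)-g(\overline{x}))\,\mathrm{dist}(0,\partial g(x))\ge1$ for all $x\in\mathcal{U}$ with $g(\overline{x})<g(x)<g(\overline{x})+\eta$. *)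

(* Defs.v *)
From HB Require Import structures.
From mathcomp Require Import all_boot all_order all_algebra.
From mathcomp Require Import all_classical all_reals all_analysis.
From mathcomp Require Import ring lra.
Import Order.TTheory GRing.Theory Num.Theory.
Import numFieldNormedType.Exports.

Set Implicit Arguments.
Unset Strict Implicit.
Unset Printing Implicit Defensive.

Local Open Scope classical_set_scope.
Local Open Scope ring_scope.

(* Finite dimension comes from [Vector]. *)
HB.mixin Record NormedModule_isEuclidean (R : realType) V
    of NormedModule R V & Vector R V := {
  dot : V -> V -> R;
  dotC : forall x y, dot x y = dot y x;
  dotDl : forall x y z, dot (x + y) z = dot x z + dot y z;
  dotZl : forall a x y, dot (a *: x) y = a * dot x y;
  dot_norm : forall x, dot x x = `|x| ^+ 2
}.

#[short(type="euclideanType")]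
HB.structure Definition Euclidean (R : realType) :=
  {V of NormedModule_isEuclidean R V & NormedModule R V & Vector R V}.

HB.factory Record Vector_isEuclidean (R : realType) V of Vector R V := {
  dot : V -> V -> R;
  dotC : forall x y, dot x y = dot y x;
  dotDl : forall x y z, dot (x + y) z = dot x z + dot y z;
  dotZl : forall a x y, dot (a *: x) y = a * dot x y;
  dot_gt0 : forall x, x != 0 -> 0 < dot x x
}.

HB.builders Context R V of Vector_isEuclidean R V.

Let norm (x : V) : R := Num.sqrt (dot x x).

Let dot0l y : dot 0 y = 0.
Proof. by rewrite -(scale0r 0) dotZl mul0r. Qed.

Let dot_ge0 x : 0 <= dot x x.
Proof. by have [->|/dot_gt0/ltW//] := eqVneq x 0; rewrite dot0l. Qed.

Let dotDD x y : dot (x + y) (x + y) = dot x x + dot x y *+ 2 + dot y y.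
Proof.
rewrite dotDl (dotC x) (dotC y (x + y)) !dotDl (dotC y x) mulr2n; ring.
Qed.

Let norm_sqr x : norm x ^+ 2 = dot x x.
Proof. by rewrite sqr_sqrtr. Qed.

Let cauchy_schwarz x y : dot x y <= norm x * norm y.
Proof.
have [->|x0] := eqVneq x 0.
  by rewrite dot0l mulr_ge0// sqrtr_ge0.
rewrite (le_trans (ler_norm _))// -(@ler_pXn2r _ 2)// ?nnegrE ?mulr_ge0//
  ?sqrtr_ge0//.
rewrite real_normK ?num_real// exprMn !norm_sqr.
have := dot_ge0 (- (dot x y / dot x x) *: x + y).
have dx := dot_gt0 x0.
rewrite dotDD !dotZl (dotC x (_ *: x)) dotZl.
rewrite -(ler_pM2l dx) mulr0.
have -> : dot x x * (- (dot x y / dot x x) * (- (dot x y / dot x x) * dot x x)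
   + (- (dot x y / dot x x) * dot x y) *+ 2 + dot y y)
   = dot x x * dot y y - dot x y ^+ 2.
  by field; rewrite gt_eqF.
by rewrite subr_ge0.
Qed.

Let norm_triangle x y : norm (x + y) <= norm x + norm y.
Proof.
rewrite -(@ler_pXn2r _ 2)// ?nnegrE ?addr_ge0// ?sqrtr_ge0//.
rewrite norm_sqr dotDD sqrrD !norm_sqr lerD2r lerD2l ler_pMn2r//.
Qed.

Let normZ (a : R) x : norm (a *: x) = `|a| * norm x.
Proof.
rewrite /norm dotZl dotC dotZl mulrA -expr2 sqrtrM ?sqr_ge0//.
by rewrite sqrtr_sqr.
Qed.

Let norm0_eq0 x : norm x = 0 -> x = 0.
Proof.
move=> nx; apply/eqP; apply: contraT => /dot_gt0.
by rewrite -norm_sqr nx expr0n ltxx.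
Qed.

HB.instance Definition _ :=
  Lmodule_isNormed.Build R V norm_triangle normZ norm0_eq0.

Let dot_normE x : dot x x = `|x| ^+ 2.
Proof. by rewrite -norm_sqr. Qed.

HB.instance Definition _ :=
  NormedModule_isEuclidean.Build R V dotC dotDl dotZl dot_normE.

HB.end.

Section OrthonormalBasis.
Context {R : realType} {V : euclideanType R}.
Implicit Types (x y : V) (s : seq V).

Lemma dotDr x y z : dot x (y + z) = dot x y + dot x z.
Proof. by rewrite dotC dotDl !(dotC _ x). Qed.

Lemma dotZr a x y : dot x (a *: y) = a * dot x y.
Proof. by rewrite dotC dotZl (dotC y). Qed.

Lemma dot0l x : dot 0 x = 0 :> R.
Proof. by rewrite -(scale0r 0) dotZl mul0r. Qed.

Lemma dot0r x : dot x 0 = 0 :> R.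
Proof. by rewrite dotC dot0l. Qed.

Lemma dotNl x y : dot (- x) y = - dot x y :> R.
Proof. by rewrite -scaleN1r dotZl mulN1r. Qed.

Lemma dot_suml (I : Type) (r : seq I) (f : I -> V) y :
  dot (\sum_(i <- r) f i) y = \sum_(i <- r) dot (f i) y.
Proof.
by elim/big_ind2 : _ => [|? ? ? ? <- <-|//]; rewrite ?dot0l ?dotDl.
Qed.

Lemma dot_inj x y : (forall z, dot z x = dot z y) -> x = y.
Proof.
move=> xy; apply/eqP; rewrite -subr_eq0 -normr_eq0 -sqrf_eq0 -dot_norm.
by rewrite -scaleN1r dotDr dotZr xy mulN1r subrr.
Qed.

(* For an orthonormal list this says that it spans the whole space. *)
Definition expands s x := x = \sum_(e <- s) dot x e *: e.

Definition orthonormal_seq s :=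
  uniq s /\ {in s &, forall e e', dot e e' = (e == e')%:R}.

Lemma dot_orthonormal_sum s (c : V -> R) e : orthonormal_seq s -> e \in s ->
  dot (\sum_(e' <- s) c e' *: e') e = c e.
Proof.
move=> [us os] es; rewrite dot_suml (bigD1_seq e)//= dotZl os// eqxx mulr1.
rewrite big_seq_cond big1 ?addr0// => e' /andP[e's /negPf ee'].
by rewrite dotZl os// ee' mulr0.
Qed.

Lemma expandsD s a x y : expands s x -> expands s y -> expands s (a *: x + y).
Proof.
move=> ex ey; rewrite /expands {1}ex {1}ey scaler_sumr -big_split/=.
by apply: eq_bigr => e _; rewrite dotDl dotZl scalerDl scalerA.
Qed.

Lemma orthonormal_exists_span s :
  exists t, orthonormal_seq t /\ {in span s, forall x, expands t x}.
Proof.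
elim: s => [|v s [t [ot et]]].
  exists [::]; split=> [//|x]; rewrite span_nil memv0 => /eqP ->.
  by rewrite /expands big_nil.
have [ev|nev] := pselect (expands t v).
  exists t; split=> // x; rewrite span_cons => /memv_addP[_ /vlineP[a ->]].
  by move=> [y /et ey ->]; exact: expandsD.
pose w := v - \sum_(e <- t) dot v e *: e.
have wt e : e \in t -> dot w e = 0.
  by move=> te; rewrite dotDl dotNl dot_orthonormal_sum// subrr.
have w0 : `|w| != 0.
  by rewrite normr_eq0; apply: contra_notN nev; rewrite subr_eq0 => /eqP.
pose u := `|w|^-1 *: w.
have uu : dot u u = 1.
  by rewrite dotZl dotZr dot_norm expr2 mulKf// mulVf.
have ut e : e \in t -> dot u e = 0 by move=> te; rewrite dotZl wt// mulr0.
have unt : u \notin t.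
  by apply/negP => /ut; rewrite uu => /eqP; rewrite oner_eq0.
have sumu x c : x = \sum_(e <- t) c e *: e -> dot x u = 0.
  move=> ->; rewrite dot_suml big_seq big1// => e te.
  by rewrite dotZl dotC ut// mulr0.
have ev : expands (u :: t) v.
  rewrite /expands big_cons -[X in dot X u](subrK (\sum_(e <- t) dot v e *: e)).
  rewrite dotDl (sumu (\sum_(e <- t) dot v e *: e) (dot v))// addr0 -/w.
  by rewrite dotZr dot_norm expr2 mulKf// scalerA mulfV// scale1r subrK.
exists (u :: t); split; last first.
  move=> x; rewrite span_cons => /memv_addP[_ /vlineP[a ->] [y yt ->]].
  apply: expandsD => //; rewrite /expands big_cons (sumu _ _ (et _ yt)).
  by rewrite scale0r add0r; exact: et.
split; first by rewrite /= unt; case: ot.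
move=> e e'; rewrite !inE => /predU1P[->|te] /predU1P[->|te'].
- by rewrite eqxx.
- by rewrite ut// (negPf (memPnC unt _ te')).
- by rewrite dotC ut// (negPf (memPn unt _ te)).
- by case: ot => _; exact.
Qed.

Lemma orthonormal_basis_exists :
  exists s, orthonormal_seq s /\ forall x, expands s x.
Proof.
have [t [ot et]] := orthonormal_exists_span (vbasis {:V}).
by exists t; split => // x; apply: et; rewrite (span_basis (vbasisP _)) memvf.
Qed.

Definition onb : seq V := sval (cid orthonormal_basis_exists).

Lemma orthonormal_onb : orthonormal_seq onb.
Proof. by case: (svalP (cid orthonormal_basis_exists)). Qed.

Lemma expands_onb x : x = \sum_(e <- onb) dot x e *: e.
Proof. by case: (svalP (cid orthonormal_basis_exists)) => _; exact. Qed.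

End OrthonormalBasis.
Arguments onb {R} V.

Section Adjoint.
Context {R : realType} {U V : euclideanType R}.

Let adjoint_fun (A : 'Hom(U, V)) (v : V) : U :=
  \sum_(e <- onb U) dot (A e) v *: e.

Definition adjoint (A : 'Hom(U, V)) : 'Hom(V, U) := linfun (adjoint_fun A).

Lemma adjointP (A : 'Hom(U, V)) x v : dot (A x) v = dot x (adjoint A v).
Proof.
have lin : linear (adjoint_fun A).
  move=> a v1 v2; rewrite /adjoint_fun scaler_sumr -big_split/=.
  by apply: eq_bigr => e _; rewrite dotDr dotZr scalerDl scalerA.
pose f := HB.pack_for {linear V -> U} (adjoint_fun A)
  (GRing.isLinear.Build _ _ _ _ _ lin).
rewrite /adjoint -[adjoint_fun A]/(f : V -> U) lfunE/= /adjoint_fun.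
rewrite {1}(expands_onb x) linear_sum dot_suml [RHS]dotC dot_suml.
by apply: eq_bigr => e _; rewrite linearZ/= dotZl dotZl mulrC (dotC e).
Qed.

End Adjoint.

(* Trace inner product tr(A^* B), computed in an orthonormal basis. *)
Section HomEuclidean.
Context {R : realType} {U V : euclideanType R}.

Let hdot (A B : 'Hom(U, V)) : R := \sum_(e <- onb U) dot (A e) (B e).

Let hdotC A B : hdot A B = hdot B A.
Proof. by apply: eq_bigr => e _; rewrite dotC. Qed.

Let hdotDl A B C : hdot (A + B) C = hdot A C + hdot B C.
Proof.
by rewrite -big_split/=; apply: eq_bigr => e _; rewrite lfunE/= dotDl.
Qed.

Let hdotZl a A B : hdot (a *: A) B = a * hdot A B.
Proof. by rewrite mulr_sumr; apply: eq_bigr => e _; rewrite lfunE/= dotZl. Qed.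

Let hdot_gt0 A : A != 0 -> 0 < hdot A A.
Proof.
move=> A0; rewrite lt_neqAle sumr_ge0 ?andbT; last first.
  by move=> e _; rewrite dot_norm sqr_ge0.
apply: contra A0; rewrite eq_sym psumr_eq0; last first.
  by move=> e _; rewrite dot_norm sqr_ge0.
move=> /allP A0; apply/eqP/lfunP => x; rewrite lfunE/= (expands_onb x).
rewrite linear_sum big_seq big1// => e /A0/=.
rewrite dot_norm sqrf_eq0 normr_eq0 => /eqP Ae.
by rewrite linearZ/= Ae scaler0.
Qed.

HB.instance Definition _ :=
  Vector_isEuclidean.Build R 'Hom(U, V) hdotC hdotDl hdotZl hdot_gt0.

End HomEuclidean.

Section SubspaceEuclidean.
Context {R : realType} {V : euclideanType R} (S : {vspace V}).

Let sdot (x y : subvs_of S) : R := dot (vsval x) (vsval y).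

Let sdotC x y : sdot x y = sdot y x.
Proof. exact: dotC. Qed.

Let sdotDl x y z : sdot (x + y) z = sdot x z + sdot y z.
Proof. by rewrite /sdot linearD dotDl. Qed.

Let sdotZl a x y : sdot (a *: x) y = a * sdot x y.
Proof. by rewrite /sdot linearZ dotZl. Qed.

Let sdot_gt0 x : x != 0 -> 0 < sdot x x.
Proof.
move=> x0; rewrite /sdot dot_norm exprn_gt0// normr_gt0.
by apply: contra x0 => /eqP vx; apply/eqP/val_inj.
Qed.

HB.instance Definition _ :=
  Vector_isEuclidean.Build R (subvs_of S) sdotC sdotDl sdotZl sdot_gt0.

End SubspaceEuclidean.

(* The product [U * V] already carries the max norm; [eprod U V] is the same
   vector space with the Euclidean norm. *)
Definition eprod (U V : Type) : Type := (U * V)%type.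

Section ProductEuclidean.
Context {R : realType} {U V : euclideanType R}.

HB.instance Definition _ := Vector.copy (eprod U V) (U * V)%type.

Let pdot (x y : eprod U V) : R := dot x.1 y.1 + dot x.2 y.2.

Let pdotC x y : pdot x y = pdot y x.
Proof. by rewrite /pdot dotC (dotC x.2). Qed.

Let pdotDl x y z : pdot (x + y) z = pdot x z + pdot y z.
Proof. by rewrite /pdot !dotDl addrACA. Qed.

Let pdotZl a x y : pdot (a *: x) y = a * pdot x y.
Proof. by rewrite /pdot !dotZl mulrDr. Qed.

Let pdot_gt0 x : x != 0 -> 0 < pdot x x.
Proof.
move=> x0; rewrite /pdot !dot_norm lt_neqAle addr_ge0 ?sqr_ge0// andbT.
apply: contra x0; rewrite eq_sym paddr_eq0 ?sqr_ge0// !sqrf_eq0 !normr_eq0.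
by case: x => x1 x2 /= /andP[/eqP -> /eqP ->].
Qed.

HB.instance Definition _ :=
  Vector_isEuclidean.Build R (eprod U V) pdotC pdotDl pdotZl pdot_gt0.

End ProductEuclidean.

Section Calculus.
Context {R : realType} {U V : euclideanType R}.

(* A meaningless total extension where [f] is not differentiable. *)
Definition fderiv (f : U -> V) (x : U) : 'Hom(U, V) := linfun ('d f x).

Definition strictly_continuous_on (O : set U) (f : U -> V) :=
  forall x, O x -> exists2 N, nbhs x N & [lipschitz f y | y in N].

Definition C1_near (x : U) (f : U -> V) :=
  \forall y \near x, differentiable f y /\ {for y, continuous (fderiv f)}.

Definition linearize (f : U -> V) (x s : U) : V := f s + fderiv f s (x - s).

End Calculus.

Section VariationalAnalysis.
Context {R : realType} {V : euclideanType R}.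
Implicit Types (g : V -> \bar R) (x v : V) (D C : set V).
Local Open Scope ereal_scope.

Definition edom g : set V := [set x | g x < +oo].

Definition proper_on D g :=
  (forall x, D x -> -oo < g x) /\ (exists2 x, D x & edom g x).

(* Lower semicontinuity relative to [D]: [subspace D] has the induced
   topology on [D]. *)
Definition lsc_on D g := lower_semicontinuous (g : subspace D -> \bar R).

(* With values in ]-oo, +oo]; the convention 0 * +oo = 0 is harmless at the
   endpoints [t = 0] and [t = 1]. *)
Definition econvex g := forall x y (t : R), (0 <= t <= 1)%R ->
  g (t *: x + (1 - t) *: y)%R <= t%:E * g x + (1 - t)%:E * g y.

Definition conjugate g (v : V) : \bar R :=
  ereal_sup [set (dot x v)%:E - g x | x in [set: V]].

(* g y >= g x + <v, y - x> + o(|y - x|) as y -> x, with [g x] finite *)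
Definition regular_subdiff g x : set V := [set v |
  g x \is a fin_num /\
  forall e : R, (0 < e)%R -> \forall y \near x,
    g x + (dot v (y - x) - e * `|y - x|)%:E <= g y].

Definition attentive_cvg g x (xk : nat -> V) :=
  (xk @ \oo --> x) /\ (g \o xk @ \oo --> g x).

(* Painleve-Kuratowski outer limit of the set-valued map [S] along the
   sequences satisfying [conv]. *)
Definition outer_limit {W : euclideanType R} (conv : (nat -> V) -> Prop)
    (S : V -> set W) : set W := [set w | exists xk wk,
  [/\ conv xk, forall k, S (xk k) (wk k) & wk @ \oo --> w]].

Definition subdiff g x : set V := [set v |
  g x \is a fin_num /\
  outer_limit (attentive_cvg g x) (regular_subdiff g) v].

Definition pos C : set V :=
  [set v | exists (l : R) x, [/\ (0 <= l)%R, C x & v = (l *: x)%R]].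

(* [+oo] when [C] is empty *)
Definition dist0 C : \bar R := ereal_inf [set `|v|%:E | v in C].

(* [g] is only meant to be defined on the open set [D]: subdifferentials at
   points of [D] are local, so its values outside [D] are irrelevant. *)
Definition KL_property D g (p : R) xbar :=
  [/\ proper_on D g, lsc_on D g, D xbar, subdiff g xbar !=set0 &
    exists (c : R) (eta : \bar R), [/\ (0 < c)%R, 0 < eta &
      let phi (t : R) : R := (c * t `^ (1 - p))%R in
      \forall x \near xbar, g xbar < g x -> g x < g xbar + eta ->
        1 <= (phi^`()%classic (fine (g x - g xbar)))%:E * dist0 (subdiff g x)]].

Definition chi C x : \bar R := if x \in C then 0 else +oo.

End VariationalAnalysis.

Section SelfAdjoint.
Context {R : realType} (X : euclideanType R).

Definition selfadjoint_space : {vspace 'End(X)} :=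
  lker (linfun (fun Q : 'End(X) => Q - adjoint Q)).

Definition selfadjoint := subvs_of selfadjoint_space.

Implicit Types Q : selfadjoint.

Definition quadform Q (v : X) : R := dot v (vsval Q v).

Definition semidefinite : set selfadjoint :=
  [set Q | forall v, 0 <= quadform Q v].

Definition positive_definite Q := forall v, v != 0 -> 0 < quadform Q v.

Lemma selfadjointP (Q : 'End(X)) :
  Q \in selfadjoint_space <-> forall x y, dot (Q x) y = dot x (Q y).
Proof.
have lin : linear (fun Q : 'End(X) => Q - adjoint Q).
  move=> a A B; suff -> : adjoint (a *: A + B) = a *: adjoint A + adjoint B.
    by rewrite scalerBr opprD addrACA.
  apply/lfunP => v; apply: dot_inj => x.
  by rewrite -adjointP !lfunE/= !lfunE/= dotDl dotZl dotDr dotZr -!adjointP.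
pose f := HB.pack_for {linear 'End(X) -> 'End(X)}
  (fun Q : 'End(X) => Q - adjoint Q) (GRing.isLinear.Build _ _ _ _ _ lin).
rewrite memv_ker -[X in linfun X]/(f : _ -> _) lfunE/= subr_eq0; split.
  by move=> /eqP QE x y; rewrite adjointP -QE.
move=> Qsym; apply/eqP/lfunP => v; apply: dot_inj => x.
by rewrite -adjointP Qsym.
Qed.

End SelfAdjoint.

Section CompositeDC.
Context {R : realType} {X Y Z : euclideanType R}.
Variables (F : X -> Y) (G : X -> Z) (theta1 : Y -> R) (theta2 : Z -> R).
Variable h : X -> \bar R.
Local Open Scope ereal_scope.

Definition Phi (x : X) : \bar R :=
  (theta1 (F x))%:E - (theta2 (G x))%:E + h x.

(* [F], [G] are total maps; only their behaviour on [O] is constrained. *)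
Record standing_assumptions (O : set X) : Prop := {
  sa_open : open O;
  sa_dom : edom h `<=` O;
  sa_diffF : forall x, O x -> differentiable F x;
  sa_diffG : forall x, O x -> differentiable G x;
  sa_lipF : strictly_continuous_on O (fderiv F);
  sa_lipG : strictly_continuous_on O (fderiv G);
  sa_convex1 : convex_function [set: Y] theta1;
  sa_convex2 : convex_function [set: Z] theta2;
  sa_conj1 : let c := conjugate (EFin \o theta1) in {within edom c, continuous c};
  sa_proper : proper_on setT h;
  sa_lsc : lower_semicontinuous h;
  sa_convexh : econvex h;
  sa_conth : {within edom h, continuous h};
  sa_conjh : let c := conjugate h in {within edom c, continuous c};
  sa_bounded : exists m : R, forall x, m%:E <= Phi x
}.

Definition f_sep (w : eprod (eprod (eprod Y X) Z) Z) : \bar R :=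
  let: (y, s, u, z) := w in
  (theta1 y)%:E + h s + (dot u z)%:E + conjugate (EFin \o theta2) (- z)%R.

Definition Xi_tilde (w : eprod (eprod X X) Z) : \bar R :=
  let: (x, s, z) := w in
  (theta1 (linearize F x s))%:E + (dot (linearize G x s) z)%:E + h x
  + conjugate (EFin \o theta2) (- z)%R.

Definition Xi (w : eprod (eprod (eprod X X) Z) (selfadjoint X)) : \bar R :=
  let: (x, s, z, Q) := w in
  Xi_tilde (x, s, z) + (quadform Q (x - s)%R)%:E + chi (@semidefinite R X) Q.

(* Ker [nabla F(x)  I  nabla G(x)], with nabla the adjoint of the derivative *)
Definition grad_kernel (x : X) : set (Y * X * Z) :=
  [set w | let: (v, xi, z) := w in
    (adjoint (fderiv F x) v + xi + adjoint (fderiv G x) z = 0)%R].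

Definition limsup_cone (xbar : X) : set (Y * X * Z) :=
  outer_limit (fun yk => yk @ \oo --> F xbar)
    (fun y => pos (subdiff (EFin \o theta1) y))
  `*` outer_limit (attentive_cvg h xbar) (fun x => pos (subdiff h x))
  `*` outer_limit (fun zk => zk @ \oo --> G xbar)
    (fun z => pos [set - v | v in subdiff (EFin \o theta2) z]%R).

End CompositeDC.

(* Main.v *)
Require Import Defs.
From HB Require Import structures.
From mathcomp Require Import all_boot all_order all_algebra.
From mathcomp Require Import all_classical all_reals all_analysis.
From mathcomp Require Import ring lra.
Import Order.TTheory GRing.Theory Num.Theory.
Import numFieldNormedType.Exports.

(** Both functions are studied through their regular subgradients, because the KL
    inequality for limiting subgradients follows from the one for regular
    subgradients by passing to the limit ([KL_of_regular]).

    Let [y] and [u] be the linearizations of [F] and [G] at [(x, s)], so that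
    [Xi_tilde (x, s, z) = f_sep (y, x, u, z)]. A regular subgradient
    [v = (vx, vs, vz)] of [Xi_tilde] at a point near the critical one obeys the chain
    rule ([Xi_tilde_chain]): there are convex subgradients [v1] of [theta1] at [y], [xi]
    of [h] at [x] and [tau] of the conjugate of [theta2] at [- z] with
    [vx = F'(s)^* v1 + xi + G'(s)^* z], [vz = u - tau], and [vs] given by the second
    derivatives of [F] and [G], paired with [v1] and [z] and applied to [x - s]. This is
    exact although [Xi_tilde] is not convex: a regular subgradient only sees the model
    in which the smooth parts are linearized, this model is convex, and [theta1] is
    finite everywhere, so that the multiplier comes from the Hahn-Banach theorem alone
    ([fermat_multiplier]).

    Conversely [(v1, xi, z, u - tau)] is a regular subgradient of [f_sep]
    ([f_sep_regular_subdiff]), hence its norm is at least a constant times the [p]-th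
    power of the value gap. It remains to bound this norm by that of [v], and this is
    what the qualification condition gives ([multiplier_bound]): by compactness,
    [`|v1| + `|xi| + `|z| <= C `|vx|] near the critical point. Here [- z] is a subgradient
    of [theta2] at [tau], and [tau] is close to [G xbar] because [u - tau = vz] is small.

    For the function with the quadratic term, the same bound shows more: [vs] is at most
    a constant times [`|x - s| `|vx|]. In the subgradient of [Xi] the [s]-component is
    [vs - 2 Q (x - s)], so it controls [Q (x - s)], and then [x - s] itself since [Q] is
    positive definite. The quadratic term adds to the value gap only a quantity of the
    order of the square of the norm of the subgradient, which is harmless for the
    exponent [p] as soon as [2 p >= 1] ([KL_property_Xi]). *)

Set Implicit Arguments.
Unset Strict Implicit.
Unset Printing Implicit Defensive.

Local Open Scope classical_set_scope.
Local Open Scope ring_scope.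

(** * Euclidean spaces *)

Section EuclideanGeometry.
Context {R : realType}.
Implicit Types U V W : euclideanType R.

Lemma dotNr V (x y : V) : dot x (- y) = - dot x y :> R.
Proof. by rewrite dotC dotNl dotC. Qed.

Lemma dotBl V (x y z : V) : dot (x - y) z = dot x z - dot y z :> R.
Proof. by rewrite dotDl dotNl. Qed.

Lemma dotBr V (x y z : V) : dot x (y - z) = dot x y - dot x z :> R.
Proof. by rewrite dotDr dotNr. Qed.

Lemma cauchy_schwarz V (x y : V) : `|dot x y| <= `|x| * `|y| :> R.
Proof.
have [->|x0] := eqVneq x 0; first by rewrite dot0l normr0 normr0 mul0r.
have [->|y0] := eqVneq y 0; first by rewrite dot0r !normr0 mulr0.
have nx : 0 < `|x| by rewrite normr_gt0.
have ny : 0 < `|y| by rewrite normr_gt0.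
pose a := `|x|^-1 *: x; pose b := `|y|^-1 *: y.
have aa : dot a a = 1 :> R.
  by rewrite dotZl dotZr dot_norm expr2 mulKf ?mulVf// gt_eqF.
have bb : dot b b = 1 :> R.
  by rewrite dotZl dotZr dot_norm expr2 mulKf ?mulVf// gt_eqF.
have -> : dot x y = `|x| * `|y| * dot a b.
  by rewrite dotZl dotZr; field; rewrite !gt_eqF.
rewrite normrM ger0_norm ?mulr_ge0// ler_piMr ?mulr_ge0//.
have := sqr_ge0 `|a + b|; have := sqr_ge0 `|a - b|.
rewrite -!dot_norm !dotDl !dotDr !dotNl !dotNr !aa !bb (dotC b a) ler_norml.
by move=> *; lra.
Qed.

Lemma dot_le V (x y : V) : dot x y <= `|x| * `|y| :> R.
Proof. exact: le_trans (ler_norm _) (cauchy_schwarz x y). Qed.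

Lemma norm_fst_le U V (w : eprod U V) : `|w.1| <= `|w| :> R.
Proof.
rewrite -(@ler_pXn2r _ 2)// ?nnegrE// -!dot_norm.
by rewrite lerDl dot_norm sqr_ge0.
Qed.

Lemma norm_snd_le U V (w : eprod U V) : `|w.2| <= `|w| :> R.
Proof.
rewrite -(@ler_pXn2r _ 2)// ?nnegrE// -!dot_norm.
by rewrite lerDr dot_norm sqr_ge0.
Qed.

Lemma norm_eprod_le U V (w : eprod U V) : `|w| <= `|w.1| + `|w.2| :> R.
Proof.
rewrite -(@ler_pXn2r _ 2)// ?nnegrE ?addr_ge0// -!dot_norm.
rewrite [leLHS](_ : _ = `|w.1| ^+ 2 + `|w.2| ^+ 2); last by rewrite -!dot_norm.
by rewrite sqrrD; have := mulr_ge0 (normr_ge0 w.1) (normr_ge0 w.2); lra.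
Qed.

(** A constant by which the trace norm dominates the operator norm: the dimension, plus
    one to be positive even in the null space. *)
Definition hom_const V : R := (size (onb V))%:R + 1.

Lemma hom_const_gt0 V : 0 < hom_const V.
Proof. by rewrite /hom_const; have : 0 <= (size (onb V))%:R :> R by []; lra. Qed.

Lemma onb_norm V (e : V) : e \in onb V -> `|e| = 1.
Proof.
move=> eV; have [_ /(_ e e eV eV)] := @orthonormal_onb _ V.
rewrite eqxx dot_norm => /eqP; rewrite sqrf_eq1 => /orP[/eqP//|/eqP e1].
by have := normr_ge0 e; rewrite e1; lra.
Qed.

(** Each [`|A e|], for [e] in the orthonormal basis, is one term of the sum of
    squares that defines [`|A|], and the coordinates of [x] are at most [`|x|]. *)
Lemma norm_hom_le U V (A : 'Hom(U, V)) x : `|A x| <= hom_const U * `|A| * `|x|.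
Proof.
have Ae e : e \in onb U -> `|A e| <= `|A|.
  move=> eU; rewrite -(@ler_pXn2r _ 2)// ?nnegrE// -!dot_norm.
  rewrite [leRHS](_ : _ = \sum_(e <- onb U) dot (A e) (A e))//.
  rewrite (big_rem e)//= lerDl sumr_ge0// => i _.
  by rewrite dot_norm sqr_ge0.
rewrite {1}(expands_onb x) linear_sum/=.
have -> : \sum_(i <- onb U) A (dot x i *: i) = \sum_(i <- onb U) dot x i *: A i.
  by apply: eq_bigr => i _; rewrite linearZ.
apply: (@le_trans _ _ (\sum_(i <- onb U) `|A| * `|x|)).
  apply: le_trans (ler_norm_sum _ _ _) _.
  rewrite big_seq [leRHS]big_seq; apply: ler_sum => e eU.
  rewrite normrZ mulrC ler_pM ?Ae//.
  by apply: le_trans (cauchy_schwarz _ _) _; rewrite (onb_norm eU) mulr1.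
rewrite big_const_seq count_predT iter_addr_0 -[leLHS]mulr_natl.
by rewrite mulrA ler_wpM2r// ler_wpM2r// lerDl.
Qed.

Lemma norm_adjoint_le U V (A : 'Hom(U, V)) v :
  `|adjoint A v| <= hom_const U * `|A| * `|v|.
Proof.
have [->|n0] := eqVneq `|adjoint A v| 0.
  by rewrite !mulr_ge0// ltW// hom_const_gt0.
have n1 : 0 < `|adjoint A v| by rewrite lt_neqAle eq_sym n0/=.
rewrite -(ler_pM2l n1) -expr2 -dot_norm -adjointP.
apply: le_trans (dot_le _ _) _.
apply: le_trans (ler_wpM2r (normr_ge0 _) (norm_hom_le _ _)) _.
by rewrite le_eqVlt; apply/orP; left; apply/eqP; ring.
Qed.

Lemma adjointB U V (A B : 'Hom(U, V)) v :
  adjoint (A - B) v = adjoint A v - adjoint B v.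
Proof.
by apply: dot_inj => x; rewrite dotBr -!adjointP !lfunE/= lfunE/= dotBl.
Qed.

Lemma riesz V (l : V -> R) : linear l -> exists v, forall x, l x = dot v x.
Proof.
move=> lin; exists (\sum_(e <- onb V) l e *: e) => x.
pose f := HB.pack_for {linear V -> R^o} (l : V -> R^o)
  (GRing.isLinear.Build _ _ _ _ _ lin).
rewrite {1}(expands_onb x) -[l]/(f : _ -> _) linear_sum dot_suml.
by apply: eq_bigr => e _; rewrite linearZ dotZl (dotC x) [LHS]mulrC.
Qed.

Lemma increasing_seq_cvg (f : nat -> nat) : increasing_seq f -> f @ \oo --> \oo.
Proof.
move=> /increasing_seqP fi; apply/cvgnyPge => A.
suff fn n : (n <= f n)%N by exists A => // n /= An; apply: leq_trans An (fn n).
by elim: n => // n; move: (fi n); rewrite ltEnat/= => /[swap]; exact: leq_ltn_trans.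
Qed.

(** The Bolzano-Weierstrass theorem, obtained by extracting a subsequence once for
    each coordinate in the orthonormal basis. *)
Lemma bounded_cvg_subseq V (u : nat -> V) (M : R) : (forall n, `|u n| <= M) ->
  exists2 f : nat -> nat, increasing_seq f & exists l : V, u \o f @ \oo --> l.
Proof.
move=> uM.
suff [f fi fc] : exists2 f : nat -> nat, increasing_seq f &
    forall e, e \in onb V -> cvgn (fun n => dot (u (f n)) e : R).
  exists f => //.
  exists (\sum_(e <- onb V) limn (fun n => dot (u (f n)) e : R) *: e).
  have -> : u \o f = fun n => \sum_(e <- onb V) dot (u (f n)) e *: e.
    by apply/funext => n /=; rewrite -expands_onb.
  elim: (onb V) fc => [|e s IH] fc.
    rewrite big_nil; have -> : (fun n => \sum_(e <- [::]) dot (u (f n)) e *: e)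
      = fun=> 0 by apply/funext => n; rewrite big_nil.
    exact: cvg_cst.
  rewrite big_cons.
  have -> : (fun n => \sum_(i <- e :: s) dot (u (f n)) i *: i) =
     fun n => dot (u (f n)) e *: e + \sum_(i <- s) dot (u (f n)) i *: i.
    by apply/funext => n; rewrite big_cons.
  apply: cvgD; last by apply: IH => i si; apply: fc; rewrite inE si orbT.
  by apply: cvgZr_tmp; apply: fc; rewrite mem_head.
elim: (onb V) => [|e s [f fi fc]]; first by exists id.
have [|g gi gc] := @bolzano_weierstrass R (fun n => dot (u (f n)) e).
  exists (M * `|e|); split; first exact: num_real.
  move=> z zM n _ /=; apply/ltW/(le_lt_trans _ zM).
  by apply: le_trans (cauchy_schwarz _ _) _; rewrite ler_wpM2r.
exists (f \o g).
  by move=> m n /=; rewrite fi -leEnat gi.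
move=> i; rewrite inE => /predU1P[->//|si].
have := fc _ si => /cvg_ex[l cl]; apply/cvg_ex; exists l.
apply: (@cvg_comp _ _ _ g (fun n => dot (u (f n)) i) \oo \oo _ _ cl).
exact: increasing_seq_cvg.
Qed.

End EuclideanGeometry.

(** * Real-valued convex functions *)

Section ConvexAnalysis.
Context {R : realType}.

(** The convexity of the domain [C] is included, so that an extended-valued
    convex function can be handled through its real values on its domain. *)
Definition convex_on (U : lmodType R) (C : set U) (H : U -> R) :=
  forall x y (t : R), 0 <= t <= 1 -> C x -> C y ->
    C (t *: x + (1 - t) *: y) /\
    H (t *: x + (1 - t) *: y) <= t * H x + (1 - t) * H y.

Lemma convex_function_on (V : lmodType R) (T : V -> R) :
  convex_function [set: V] T -> convex_on setT T.
Proof.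
move=> cT x y t t01 _ _; split=> //.
have := cT (Itv01 (proj1 (andP t01)) (proj2 (andP t01))) x y.
by rewrite !in_setT => /(_ isT isT).
Qed.

Let lincomb (V : lmodType R) (s : seq V) (a : V -> R) : V :=
  \sum_(e <- s) a e *: e.

(** The finite-dimensional Hahn-Banach theorem, adding one direction at a time. When
    [e] is added to [s], the slopes allowed in the direction [e] must lie above all
    the left quotients and below all the right quotients of [p] relative to the
    minorant already built; convexity of [p] along the segment that joins a left
    point to a right point says that every left quotient is below every right
    one. *)
Lemma hahn_banach_span (V : lmodType R) (p : V -> R) (s : seq V) :
  convex_on setT p -> 0 <= p 0 -> uniq s ->
  exists c : V -> R, forall a : V -> R,
    \sum_(e <- s) a e * c e <= p (\sum_(e <- s) a e *: e).
Proof.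
move=> cp p0; elim: s => [_|e s IH /= /andP[es us]].
  by exists (fun=> 0) => a; rewrite !big_nil.
have [c cP] := IH us.
pose l a := \sum_(i <- s) a i * c i; pose A a := lincomb s a.
pose S : set R :=
  [set r | exists a t, 0 < t /\ r = (l a - p (A a - t *: e)) / t].
have key a t a' t' : 0 < t -> 0 < t' ->
    (l a - p (A a - t *: e)) / t <= (p (A a' + t' *: e) - l a') / t'.
  move=> t0 t0'; rewrite ler_pdivrMr// mulrAC ler_pdivlMr//.
  have [k kE] : exists k, k = t' / (t + t') by eexists.
  have tt : 0 < t + t' by rewrite addr_gt0.
  have k01 : 0 <= k <= 1.
    apply/andP; split; first by rewrite kE divr_ge0// ltW.
    by rewrite kE ler_pdivrMr// mul1r lerDr ltW.
  have [_ pk] := cp (A a - t *: e) (A a' + t' *: e) k k01 I I.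
  have Ak : k *: (A a - t *: e) + (1 - k) *: (A a' + t' *: e) =
      A (fun i => k * a i + (1 - k) * a' i).
    rewrite scalerBr scalerDr !scalerA addrACA.
    have -> : k * t = (1 - k) * t' by rewrite kE; field; rewrite gt_eqF.
    rewrite addNr addr0 /A /lincomb !scaler_sumr -big_split/=.
    by apply: eq_bigr => i _; rewrite [RHS]scalerDl !scalerA.
  have lk : l (fun i => k * a i + (1 - k) * a' i) = k * l a + (1 - k) * l a'.
    rewrite /l !mulr_sumr -big_split/=; apply: eq_bigr => i _; ring.
  have I1 : k * l a + (1 - k) * l a' <=
      k * p (A a - t *: e) + (1 - k) * p (A a' + t' *: e).
    by rewrite -lk; apply: le_trans pk; rewrite Ak; exact: cP.
  have := ler_wpM2l (ltW tt) I1; rewrite !mulrDr !(mulrA (t + t')).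
  have -> : (t + t') * k = t' by rewrite kE; field; rewrite gt_eqF.
  have -> : (t + t') * (1 - k) = t by rewrite kE; field; rewrite gt_eqF.
  lra.
have S0 : S !=set0.
  by exists ((l (fun=> 0) - p (A (fun=> 0) - 1 *: e)) / 1), (fun=> 0), 1.
pose al := sup S.
have alP a t : 0 < t -> (l a - p (A a - t *: e)) / t <= al.
  move=> t0; apply: ub_le_sup; last by exists a, t.
  exists ((p (A a + t *: e) - l a) / t) => _ [a' [t' [t0' ->]]]; exact: key.
have alP' a t : 0 < t -> al <= (p (A a + t *: e) - l a) / t.
  by move=> t0; apply: ge_sup => // _ [a' [t' [t0' ->]]]; exact: key.
(* Since [e] is not in [s], overriding [c] at [e] does not disturb the
   coefficients already chosen. *)
exists (fun i => if i == e then al else c i) => a.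
rewrite !big_cons eqxx.
have -> : \sum_(j <- s) a j * (if j == e then al else c j) = l a.
  rewrite /l big_seq [RHS]big_seq; apply: eq_bigr => i si.
  by case: eqP => // ie; rewrite -ie si in es.
rewrite -/(lincomb s a) -/(A a).
have [ae|ae|<-] := ltgtP 0 (a e).
- have := alP' a _ ae; rewrite ler_pdivlMr//.
  by rewrite (addrC (A a)); lra.
- have := alP a (- a e); rewrite oppr_gt0 => /(_ ae).
  rewrite scaleNr opprK (addrC (A a)) ler_pdivrMr ?oppr_gt0//; lra.
- by rewrite mul0r scale0r !add0r; exact: cP.
Qed.

Lemma hahn_banach (V : euclideanType R) (p : V -> R) :
  convex_on setT p -> 0 <= p 0 -> exists v : V, forall x, dot v x <= p x.
Proof.
move=> cp p0.
have uV : uniq (onb V) by have [] := @orthonormal_onb _ V.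
have [c cP] := hahn_banach_span cp p0 uV.
exists (\sum_(e <- onb V) c e *: e) => x.
rewrite [in leRHS](expands_onb x); apply: le_trans (cP (dot x)).
rewrite dot_suml le_eqVlt; apply/orP; left; apply/eqP.
by apply: eq_bigr => e _; rewrite dotZl dotC mulrC.
Qed.

(** Fermat's rule together with the sum and chain rules. The perturbation function
    [y |-> inf_d (T (y + A d) + H d)] is convex, nonnegative at [0], and finite because
    [T] is, so that it has a linear minorant [v]; taking [d = 0] bounds [v] by [T], and
    taking [y = - A d] bounds [- v (A d)] by [H d]. *)
Lemma fermat_multiplier (U : lmodType R) (Y : euclideanType R) (C : set U)
    (H : U -> R) (A : {linear U -> Y}) (T : Y -> R) :
  convex_on setT T -> T 0 = 0 -> convex_on C H -> C 0 -> H 0 = 0 ->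
  (forall d, C d -> 0 <= T (A d) + H d) ->
  exists v, (forall y, dot v y <= T y) /\
            (forall d, C d -> 0 <= dot v (A d) + H d).
Proof.
move=> cT T0 cH C0 H0 TH.
pose S y : set R := [set T (y + A d) + H d | d in C].
have S0 y : S y !=set0 by exists (T (y + A 0) + H 0), 0.
have Slb y : lbound (S y) (- T (- y)).
  move=> _ [d Cd <-].
  have h01 : 0 <= (2^-1 : R) <= 1 by lra.
  have [Cd2 Hd2] := cH d 0 _ h01 Cd C0.
  have [_ Td2] := cT (y + A d) (- y) _ h01 I I.
  have half : 1 - 2^-1 = 2^-1 :> R by lra.
  have := TH _ Cd2; move: Hd2 Td2; rewrite half H0 scaler0 addr0 linearZ/=.
  have -> : 2^-1 *: (y + A d) + 2^-1 *: (- y) = 2^-1 *: A d.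
    by rewrite -scalerDr addrAC subrr add0r.
  lra.
(* The bound on [S y] comes from comparing the values at [y] and at [- y]. *)
pose p y := inf (S y).
have pP y d : C d -> p y <= T (y + A d) + H d.
  move=> Cd; apply: ge_inf; last by exists d.
  by exists (- T (- y)); exact: Slb.
have cp : convex_on setT p.
  move=> y y' t /andP[t0 t1] _ _; split=> //.
  apply/ler_addgt0Pr => e e0.
  have [_ [d Cd <-] yd] : exists2 r, S y r & r < p y + e.
    by apply: inf_adherent => //; split=> //; exists (- T (- y)); exact: Slb.
  have [_ [d' Cd' <-] yd'] : exists2 r, S y' r & r < p y' + e.
    by apply: inf_adherent => //; split=> //; exists (- T (- y')); exact: Slb.
  have t01 : 0 <= t <= 1 by rewrite t0.
  have [Cdd Hdd] := cH d d' _ t01 Cd Cd'.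
  have [_ Tdd] := cT (y + A d) (y' + A d') _ t01 I I.
  apply: le_trans (pP _ _ Cdd) _.
  have -> : t *: y + (1 - t) *: y' + A (t *: d + (1 - t) *: d') =
     t *: (y + A d) + (1 - t) *: (y' + A d').
    by rewrite linearD !linearZ/= addrACA !scalerDr.
  have := ler_wpM2l t0 (ltW yd).
  have t0' : 0 <= 1 - t by rewrite subr_ge0.
  have := ler_wpM2l t0' (ltW yd').
  lra.
have [|v vP] := hahn_banach cp.
  by apply: lb_le_inf => // _ [d Cd <-]; rewrite add0r; exact: TH.
exists v; split=> [y|d Cd].
  by apply: le_trans (vP y) _; rewrite -[y in leRHS]addr0 -(linear0 A)
     -[leRHS]addr0 -H0; exact: pP.
have := le_trans (vP (- A d)) (pP (- A d) d Cd).
by rewrite addNr T0 dotNr; lra.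
Qed.

Definition convex_subgradient (V : euclideanType R) (g : V -> \bar R)
    (x v : V) :=
  g x \is a fin_num /\ forall y, (g x + (dot v (y - x))%:E <= g y)%E.

Lemma convex_subgradientE (V : euclideanType R) (T : V -> R) (x v : V) :
  convex_subgradient (EFin \o T) x v <->
  forall y, T x + dot v (y - x) <= T y.
Proof.
split=> [[_ Tv] y|Tv]; first by have := Tv y; rewrite /= -EFinD lee_fin.
by split=> // y; rewrite /= -EFinD lee_fin.
Qed.

Lemma convex_subgradient_regular (V : euclideanType R) (g : V -> \bar R)
    (x v : V) : convex_subgradient g x v -> regular_subdiff g x v.
Proof.
move=> [fg gv]; split=> // e e0; near=> y.
apply: le_trans (gv y); apply: leeD => //; rewrite lee_fin.
by rewrite gerBl mulr_ge0// ltW.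
Unshelve. all: by end_near. Qed.

Lemma regular_subdiffW (V : euclideanType R) (g : V -> \bar R) (x v : V) :
  regular_subdiff g x v -> subdiff g x v.
Proof.
move=> gv; split; first by case: gv.
by exists (fun=> x), (fun=> v); split=> //; [split|]; exact: cvg_cst.
Qed.

Lemma convex_subgradient_exists (V : euclideanType R) (T : V -> R) (x : V) :
  convex_on setT T -> exists v, convex_subgradient (EFin \o T) x v.
Proof.
move=> cT; have [||v vP] := @hahn_banach V (fun y => T (x + y) - T x).
- move=> y y' t t01 _ _; split=> //.
  have [_] := cT (x + y) (x + y') _ t01 I I.
  have -> : t *: (x + y) + (1 - t) *: (x + y') =
      x + (t *: y + (1 - t) *: y').
    by rewrite !scalerDr addrACA -scalerDl subrKC scale1r.
  lra.
- by rewrite addr0 subrr.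
exists v; apply/convex_subgradientE => y.
by have := vP (y - x); rewrite subrKC; lra.
Qed.

(** [x + a e + w] is the midpoint of [x + 2 a e] and [x + 2 w], and the first of these
    two points stays in a fixed segment, on which a convex function is bounded by its
    values at the end points. *)
Lemma convex_bounded_above (V : lmodType R) (T : V -> R) (s : seq V) :
  convex_on setT T -> forall (x : V) (r : R), exists M, forall a : V -> R,
    (forall e, `|a e| <= r) -> T (x + \sum_(e <- s) a e *: e) <= M.
Proof.
move=> cT x; elim: s => [|e s IH] r.
  by exists (T x) => a _; rewrite big_nil addr0.
have [M MP] := IH (2 * r).
exists (`|T (x + (2 * r) *: e)| + `|T (x - (2 * r) *: e)| + `|M|) => a ar.
rewrite big_cons.
have {}MP : T (x + \sum_(i <- s) (2 * a i) *: i) <= M.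
  by apply: MP => i; rewrite normrM ger0_norm// ler_pM2l.
have h01 : 0 <= (2^-1 : R) <= 1 by lra.
have [_] := cT (x + (2 * a e) *: e) (x + \sum_(i <- s) (2 * a i) *: i) _ h01 I I.
have -> : 1 - 2^-1 = 2^-1 :> R by lra.
have -> : 2^-1 *: (x + (2 * a e) *: e) +
  2^-1 *: (x + \sum_(i <- s) (2 * a i) *: i) =
  x + (a e *: e + \sum_(i <- s) a i *: i).
  rewrite -scalerDr addrACA -mulr2n scalerDr -(scaler_nat 2 x) scalerA mulVf//.
  rewrite scale1r scalerDr scalerA mulKf// scaler_sumr; congr (_ + (_ + _)).
  by apply: eq_bigr => i _; rewrite scalerA mulKf.
move=> /le_trans; apply.
have r0 : 0 <= r by apply: le_trans (ar e).
have {}ar : `|a e| <= r := ar e.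
suff : T (x + (2 * a e) *: e) <=
    `|T (x + (2 * r) *: e)| + `|T (x - (2 * r) *: e)|.
  have := ler_norm M; have := normr_ge0 M.
  have := normr_ge0 (T (x + (2 * r) *: e)).
  have := normr_ge0 (T (x - (2 * r) *: e)); lra.
have [r1|r1] := eqVneq r 0.
  move: ar; rewrite r1 normr_le0 => /eqP ->; rewrite mulr0 scale0r addr0.
  by rewrite (le_trans (ler_norm _))// lerDl.
have rp : 0 < r by rewrite lt_neqAle eq_sym r1.
have [t tE] : exists t, t = (a e + r) / (2 * r) by eexists.
move: ar; rewrite ler_norml => /andP[ar1 ar2].
have t01 : 0 <= t <= 1.
  rewrite tE; apply/andP; split; first by rewrite divr_ge0; lra.
  by rewrite ler_pdivrMr; lra.
have [_] := cT (x + (2 * r) *: e) (x - (2 * r) *: e) _ t01 I I.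
have -> : t *: (x + (2 * r) *: e) + (1 - t) *: (x - (2 * r) *: e) =
  x + (2 * a e) *: e.
  rewrite !scalerDr addrACA -scalerDl subrKC scale1r; congr (_ + _).
  rewrite -scaleNr !scalerA -scalerDl; congr (_ *: _); rewrite tE; field.
  by rewrite gt_eqF.
move=> /le_trans; apply; case/andP: t01 => t0 t1; apply: lerD.
  apply: le_trans (ler_norm _) _; rewrite normrM (ger0_norm t0).
  by rewrite ler_piMl.
apply: le_trans (ler_norm _) _; rewrite normrM ger0_norm ?subr_ge0//.
by rewrite ler_piMl// gerBl.
Qed.

(** On a ball of radius [2] the function is bounded above by [convex_bounded_above] and
    below by an affine minorant. A subgradient [v] at distance at most [1] from the
    centre makes the function grow by [`|v|] over a unit step, hence is bounded; the
    Lipschitz estimate follows from the existence of subgradients. *)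
Lemma convex_locally_lipschitz (V : euclideanType R) (T : V -> R) (x : V) :
  convex_on setT T -> exists2 L : R, 0 < L & forall y, `|y - x| <= 1 ->
    (forall v, convex_subgradient (EFin \o T) y v -> `|v| <= L) /\
    (forall z, T y - T z <= L * `|y - z|).
Proof.
move=> cT.
have [M MP] := convex_bounded_above (onb V) cT x 2.
have [w /convex_subgradientE wP] := convex_subgradient_exists x cT.
have TM y : `|y - x| <= 2 -> T y <= M.
  move=> yx; pose a e := if e \in onb V then dot (y - x) e else 0.
  have -> : y = x + \sum_(e <- onb V) a e *: e.
    rewrite -[LHS](subrKC x) [in LHS](expands_onb (y - x)); congr (_ + _).
    by rewrite big_seq [RHS]big_seq; apply: eq_bigr => e; rewrite /a => ->.
  apply: MP => e; rewrite /a; case: ifPn => [eV|]; last by rewrite normr0.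
  by apply: le_trans (cauchy_schwarz _ _) _; rewrite (onb_norm eV) mulr1.
have Tm y : `|y - x| <= 2 -> T x - `|w| * 2 <= T y.
  move=> yx; apply: le_trans (wP y).
  have := ler_wpM2l (normr_ge0 w) yx; have := cauchy_schwarz w (y - x).
  by rewrite ler_norml => /andP[]; lra.
pose L := `|M - T x + `|w| * 2| + 1.
have sub y v : `|y - x| <= 1 -> convex_subgradient (EFin \o T) y v -> `|v| <= L.
  move=> yx /convex_subgradientE vP.
  have [->|v0] := eqVneq v 0; first by rewrite normr0 addr_ge0.
  have nv : 0 < `|v| by rewrite normr_gt0.
  have n1 : `| `|v|^-1 *: v| = 1.
    by rewrite normrZ ger0_norm ?invr_ge0// mulVf// gt_eqF.
  have := vP (y + `|v|^-1 *: v).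
  rewrite addrAC subrr add0r dotZr dot_norm expr2 mulKf ?gt_eqF// => Tv.
  have /TM : `|y + `|v|^-1 *: v - x| <= 2.
    by rewrite addrAC; apply: le_trans (ler_normD _ _) _; rewrite n1; lra.
  have : `|y - x| <= 2 by lra.
  move=> /Tm; rewrite /L; have := ler_norm (M - T x + `|w| * 2); lra.
exists L; first by rewrite /L; have := normr_ge0 (M - T x + `|w| * 2); lra.
move=> y yx; split=> [v|z]; first exact: sub.
have [v vy] := convex_subgradient_exists y cT.
have vL := sub _ _ yx vy; have /convex_subgradientE/(_ z) := vy.
have := cauchy_schwarz v (z - y); rewrite ler_norml => /andP[+ _].
have := ler_wpM2r (normr_ge0 (z - y)) vL; rewrite (distrC y); lra.
Qed.

Lemma convex_continuous (V : euclideanType R) (T : V -> R) :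
  convex_on setT T -> continuous T.
Proof.
move=> cT x; have [L L0 LP] := convex_locally_lipschitz x cT.
apply/cvgrPdist_lt => e e0; near=> y.
have yx : `|y - x| < Num.min 1 (e / L).
  near: y; apply: (@cvgr_distC_lt _ _ _ _ _ id x); first exact: cvg_id.
  by rewrite lt_min ltr01 divr_gt0.
move: yx; rewrite lt_min ltr_pdivlMr// => /andP[y1 yL].
have [_ Ty] := LP _ (ltW y1).
have x1 : `|x - x| <= 1 by rewrite subrr normr0.
have [_ Tx] := LP _ x1.
by have := Ty x; have := Tx y; rewrite (distrC x) ltr_norml; lra.
Unshelve. all: by end_near. Qed.

End ConvexAnalysis.

(** * The KL inequality for limiting and for regular subgradients *)

Section KurdykaLojasiewicz.
Context {R : realType} {V : euclideanType R}.
Implicit Types (g : V -> \bar R) (p : R).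

(** With [phi t = c t^(1 - p)], the inequality of the KL property reads
    [t^p <= c (1 - p) dist]: this is the form used everywhere below. *)
Lemma desingularizing_derive (c p t : R) : 0 < t ->
  (fun t => c * t `^ (1 - p))^`()%classic t = c * (1 - p) * t `^ (- p).
Proof.
move=> t0; rewrite derive1E.
have -> : (fun t => c * t `^ (1 - p)) = c \*: ((@powR R)^~ (1 - p) : R -> R^o) by [].
have dp := is_derive1_powR (1 - p) t0.
rewrite deriveZ//; rewrite derive_val [LHS]mulrA; congr (_ * _ `^ _); ring.
Qed.

Lemma powRN_mul (p t : R) : 0 < t -> t `^ (- p) * t `^ p = 1.
Proof.
by move=> t0; rewrite powRN mulVf// gt_eqF// powR_gt0.
Qed.

Lemma KL_lower_bound D g p (x : V) : 0 <= p < 1 -> KL_property D g p x ->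
  exists c eta : R, [/\ 0 < c, 0 < eta & \forall y \near x, forall b v,
    g y = b%:E -> 0 < b - fine (g x) < eta -> subdiff g y v ->
    c * (b - fine (g x)) `^ p <= `|v|].
Proof.
move=> /andP[p0 p1] [_ _ _ [w [gxf _]] [c [eta [c0 eta0 KL]]]].
have cp : 0 < c * (1 - p) by rewrite mulr_gt0// subr_gt0.
have [eta' eta'0 etaE] : exists2 e : R, 0 < e & (e%:E <= eta)%E.
  by case: eta eta0 {KL} => [r|_|//]; [exists r|exists 1; rewrite ?leey].
exists (c * (1 - p))^-1, eta'; split; rewrite ?invr_gt0//.
have [a gxa] : exists a, g x = a%:E by exists (fine (g x)); rewrite fineK.
rewrite gxa /= in KL *.
near=> y => b v gyb /andP[b0 b1] gv.
have : (a%:E < g y -> g y < a%:E + eta ->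
  1 <= ((fun t : R => c * t `^ (1 - p))^`()%classic (fine (g y - a%:E)))%:E
       * dist0 (subdiff g y))%E by near: y.
rewrite gyb lte_fin -subr_gt0 b0 => /(_ isT) KLy.
have {}/KLy : (b%:E < a%:E + eta)%E.
  by apply: lt_le_trans (leeD (lexx _) etaE); rewrite -EFinD lte_fin; lra.
rewrite /= desingularizing_derive//; set t := b - _ => KLy.
have dv : (dist0 (subdiff g y) <= `|v|%:E)%E by apply: ereal_inf_lbound; exists v.
have : (1 <= (c * (1 - p) * t `^ (- p) * `|v|)%:E)%E.
  apply: le_trans KLy _; rewrite [leRHS]EFinM; apply: lee_wpmul2l => //.
  by rewrite lee_fin mulr_ge0// ?powR_ge0// ltW.
rewrite lee_fin => KL1; rewrite mulrC ler_pdivrMr// mulrC -[leLHS]mul1r.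
have tp : 0 <= t `^ p by exact: powR_ge0.
apply: le_trans (ler_wpM2r tp KL1) _.
by rewrite mulrAC -(mulrA (c * _)) powRN_mul// mulr1 mulrC.
Unshelve. all: by end_near. Qed.

(** A bound on the regular subgradients near [x] suffices: a limiting subgradient at
    [y] is a limit of regular ones at points whose values tend to [g y], and since
    [g y] exceeds [g x] strictly, these values eventually satisfy the same strict
    inequalities, while [t^p] is continuous at positive [t]. *)
Lemma KL_of_regular D g p (x : V) (c eta : R) : 0 <= p < 1 ->
  proper_on D g -> lsc_on D g -> D x -> subdiff g x !=set0 ->
  0 < c -> 0 < eta ->
  (\forall y \near x, forall b v, g y = b%:E -> 0 < b - fine (g x) < eta ->
    regular_subdiff g y v -> c * (b - fine (g x)) `^ p <= `|v|) ->
  KL_property D g p x.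
Proof.
move=> /andP[p0 p1] gp gl Dx gs c0 eta0 reg; split=> //.
have gxf : g x \is a fin_num by case: gs => w [].
have p1' : 0 < 1 - p by rewrite subr_gt0.
exists (c * (1 - p))^-1, eta%:E; rewrite lte_fin invr_gt0 mulr_gt0//; split=> //.
near=> y => gy1 gy2.
have reg_y : \forall y' \near y, forall b v, g y' = b%:E ->
    0 < b - fine (g x) < eta -> regular_subdiff g y' v ->
    c * (b - fine (g x)) `^ p <= `|v| by near: y; exact: near_join.
have [b gyb] : exists b, g y = b%:E.
  exists (fine (g y)); rewrite fineK// fin_numE; apply/andP; split.
    by apply: contraTneq gy1 => ->; rewrite ltNge leNye.
  by apply: contraTneq gy2 => ->; rewrite -leNgt leey.
set a := fine (g x).
have gxa : g x = a%:E by rewrite fineK.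
move: gy1 gy2; rewrite gyb gxa -EFinD !lte_fin => ab ba /=.
have t0 : 0 < b - a by rewrite subr_gt0.
rewrite desingularizing_derive//.
have -> : (c * (1 - p))^-1 * (1 - p) * (b - a) `^ (- p) =
   (c * (b - a) `^ p)^-1.
  rewrite powRN; have := powR_gt0 p t0 => tp; field.
  by rewrite !gt_eqF.
have tp := powR_gt0 p t0.
have ctp : 0 < c * (b - a) `^ p by rewrite mulr_gt0.
suff : ((c * (b - a) `^ p)%:E <= dist0 (subdiff g y))%E.
  have ci : (0 < ((c * (b - a) `^ p)^-1)%:E)%E by rewrite lte_fin invr_gt0.
  move=> /(lee_wpmul2l (ltW ci)); apply: le_trans.
  by rewrite -EFinM mulVf// gt_eqF.
apply: le_ereal_inf_tmp => _ [v [_ [yk [wk [[ykc gykc] rk wkc]]]] <-].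
rewrite lee_fin.
rewrite /= gyb in gykc.
move/fine_cvgP: gykc => [fk bk].
have powc : {for b - a, continuous ((@powR R)^~ p : R -> R)}.
  have dp := is_derive1_powR p t0.
  apply/differentiable_continuous/derivable1_diffP; exact: ex_derive.
have lhs : c * (fine (g (yk k)) - a) `^ p @[k --> \oo] --> c * (b - a) `^ p.
  apply: cvgM; first exact: cvg_cst.
  apply: (@cvg_comp _ _ _ _ ((@powR R)^~ p) _ _ _ _ powc).
  by apply: cvgB => //; exact: cvg_cst.
have rhs : `|wk k| @[k --> \oo] --> `|v| by exact: cvg_norm.
apply: (ler_cvg_to lhs rhs).
have rek := ykc _ reg_y.
have b1 := cvgr_gt _ bk _ ab; have b2 := cvgr_lt _ bk _ ba.
near=> k.
have regk : forall b v, g (yk k) = b%:E -> 0 < b - fine (g x) < eta ->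
  regular_subdiff g (yk k) v -> c * (b - fine (g x)) `^ p <= `|v| by near: k.
apply: regk => //; first by rewrite fineK//; near: k.
rewrite -/a subr_gt0 ltrBlDl; apply/andP; split; near: k.
  exact: b1.
exact: b2.
Unshelve. all: by end_near. Qed.

End KurdykaLojasiewicz.

(** * First-order expansions along rays *)

Section AlongRays.
Context {R : realType}.

Lemma near_dist (V : euclideanType R) (x : V) (e : R) :
  0 < e -> \forall y \near x, `|y - x| < e.
Proof. by move=> e0; apply: (@cvgr_distC_lt _ _ _ _ _ id x) => //; exact: cvg_id. Qed.

Lemma near_distP (V : euclideanType R) (x : V) (P : V -> Prop) :
  (\forall y \near x, P y) -> exists2 e : R, 0 < e & forall y, `|y - x| < e -> P y.
Proof.
move=> /nbhs_ballP[e /= e0 eP]; exists e => // y yx; apply: eP.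
by rewrite -ball_normE /= distrC.
Qed.

Lemma near_ray (V : euclideanType R) (x d : V) (P : V -> Prop) :
  (\forall y \near x, P y) -> \forall t \near (0 : R)^'+, P (x + t *: d).
Proof.
move=> xP; suff /(_ _ xP) : (x + t *: d) @[t --> (0 : R)^'+] --> x by [].
rewrite -[X in _ --> X]addr0 -(scale0r d); apply: cvgD; first exact: cvg_cst.
by apply: cvgZr_tmp; exact: cvg_at_right_filter cvg_id.
Qed.

Lemma fderivE (U V : euclideanType R) (f : U -> V) x d :
  fderiv f x d = 'd f x d.
Proof. by rewrite lfunE. Qed.

(** Only directional expansions are used, so that all the error estimates are in one
    real variable. *)
Lemma fderiv_ray (U V : euclideanType R) (f : U -> V) (x d : U) (e : R) :
  differentiable f x -> 0 < e -> \forall t \near (0 : R)^'+,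
    `|f (x + t *: d) - f x - t *: fderiv f x d| <= e * t.
Proof.
move=> df e0.
have : derivable f x d by exact: diff_derivable.
rewrite /derivable => /cvg_ex[l fl].
have lE : l = fderiv f x d.
  by rewrite fderivE -deriveE//; apply/esym/cvg_lim.
have /cvgrPdistC_lt/(_ _ e0) fle := cvg_dnbhs_at_right fl.
near=> t.
have t0 : 0 < t by near: t; exact: nbhs_right_gt.
have : `|t^-1 *: ((f \o shift x) (t *: d) - f x) - l| < e by near: t.
rewrite /= -lE (addrC x) => /ltW; rewrite -(ler_pM2l t0) (mulrC t e).
apply: le_trans; rewrite -[X in _ <= X * _](gtr0_norm t0) -normrZ scalerBr.
by rewrite (scalerA t t^-1) mulfV ?gt_eqF// scale1r.
Unshelve. all: by end_near. Qed.

Lemma linearize_self (U V : euclideanType R) (f : U -> V) (x : U) :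
  linearize f x x = f x.
Proof. by rewrite /linearize subrr linear0 addr0. Qed.

(** Moving the base point [s] contributes [- f'(s) d2] through the argument [x - s],
    which cancels the derivative of [f s]; what remains is the second derivative
    applied to [x - s]. *)
Lemma linearize_ray (X Y : euclideanType R) (f : X -> Y) (x s d1 d2 : X)
    (e : R) : differentiable f s -> differentiable (fderiv f) s -> 0 < e ->
  \forall t \near (0 : R)^'+,
    `|linearize f (x + t *: d1) (s + t *: d2) - linearize f x s
      - t *: (fderiv f s d1 + fderiv (fderiv f) s d2 (x - s))| <= e * t.
Proof.
move=> df ddf e0.
pose K := hom_const X * (`|x - s| + `|d1 - d2|) + 1.
have K0 : 0 < K.
  by rewrite /K ltr_pwDr// mulr_ge0// ?addr_ge0// ltW// hom_const_gt0.
pose e1 := e / 2; have e10 : 0 < e1 by rewrite divr_gt0.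
pose e2 := e / (2 * K); have e20 : 0 < e2 by rewrite divr_gt0// mulr_gt0.
have ct : {for s, continuous (fderiv f)} by exact: differentiable_continuous.
near=> t.
have t0 : 0 < t by near: t; exact: nbhs_right_gt.
have r1 : `|f (s + t *: d2) - f s - t *: fderiv f s d2| <= e1 * t.
  by near: t; exact: fderiv_ray.
have r2 : `|fderiv f (s + t *: d2) - fderiv f s - t *: fderiv (fderiv f) s d2|
    <= e2 * t.
  by near: t; exact: fderiv_ray.
have r3 : `|fderiv f (s + t *: d2) - fderiv f s| <= e2.
  near: t; apply: (near_ray d2 (P := fun s' => `|fderiv f s' - fderiv f s| <= e2)).
  by apply: cvgr_distC_le => //; exact: ct.
set r1' := _ - _ - _ in r1; set A := _ - _ - _ in r2; set B := _ - _ in r3.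
have -> : linearize f (x + t *: d1) (s + t *: d2) - linearize f x s
      - t *: (fderiv f s d1 + fderiv (fderiv f) s d2 (x - s)) =
    r1' + (A (x - s) + t *: B (d1 - d2)).
  rewrite /linearize.
  have -> : fderiv f (s + t *: d2) (x + t *: d1 - (s + t *: d2)) =
     fderiv f (s + t *: d2) (x - s) + t *: fderiv f (s + t *: d2) (d1 - d2).
    by rewrite -linearZ -linearD scalerBr opprD addrACA.
  have -> : A (x - s) = fderiv f (s + t *: d2) (x - s) - fderiv f s (x - s)
      - t *: fderiv (fderiv f) s d2 (x - s).
    by rewrite /A !(add_lfunE, opp_lfunE, scale_lfunE).
  have -> : B (d1 - d2) = fderiv f (s + t *: d2) (d1 - d2)
      - (fderiv f s d1 - fderiv f s d2) 
    by rewrite /B add_lfunE opp_lfunE (linearB (fderiv f s)).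
  by apply: dot_inj => w; rewrite /r1' !(dotDr, dotNr, dotZr); ring.
apply: le_trans (ler_normD _ _) _.
have -> : e * t = e1 * t + e1 * t by rewrite /e1; field.
apply: lerD => //; apply: le_trans (ler_normD _ _) _.
have h0 := @hom_const_gt0 _ X.
have A1 : `|A (x - s)| <= hom_const X * (e2 * t) * `|x - s|.
  apply: le_trans (norm_hom_le _ _) _; rewrite ler_wpM2r// ler_wpM2l//.
  exact: ltW.
have B1 : `|t *: B (d1 - d2)| <= t * (hom_const X * e2 * `|d1 - d2|).
  rewrite normrZ gtr0_norm// ler_wpM2l ?(ltW t0)//.
  apply: le_trans (norm_hom_le _ _) _; rewrite ler_wpM2r// ler_wpM2l//.
  exact: ltW.
apply: le_trans (lerD A1 B1) _.
have -> : e1 * t = e2 * t * K.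
  by rewrite /e1 /e2; field; rewrite gt_eqF.
have : 0 <= e2 * t by rewrite ltW// mulr_gt0.
rewrite /K; lra.
Unshelve. all: by end_near. Qed.

End AlongRays.

(** * Extended-valued convex functions and conjugates *)

Section ExtendedConvex.
Context {R : realType}.
Implicit Types V : euclideanType R.

Lemma econvex_fin V (g : V -> \bar R) (x y : V) (a b t : R) : econvex g ->
  0 <= t <= 1 -> g x = a%:E -> g y = b%:E ->
  (g (t *: x + (1 - t) *: y)%R <= (t * a + (1 - t) * b)%:E)%E.
Proof.
by move=> cg t01 gx gy; have := cg x y t t01; rewrite gx gy -!EFinM -EFinD.
Qed.

(** Along the segment from [x] to [y], convexity bounds the increment of [g] by a
    multiple of [t], so that the error term can be divided by [t]. *)
Lemma regular_subdiff_convex V (g : V -> \bar R) (x v : V) :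
  econvex g -> (forall y, -oo < g y)%E -> regular_subdiff g x v ->
  convex_subgradient g x v.
Proof.
move=> cg gN [gx gv]; split=> // y.
have [gy|gy] := eqVneq (g y) +oo%E; first by rewrite gy leey.
have gyf : g y \is a fin_num by rewrite fin_numE gy andbT gt_eqF.
rewrite -(fineK gx) -(fineK gyf) -EFinD lee_fin.
set a := fine (g x); set b := fine (g y).
apply/ler_addgt0Pr => e e0.
have n0 : 0 < `|y - x| + 1 by rewrite ltr_wpDl.
have ray := near_ray (y - x) (gv _ (divr_gt0 e0 n0)).
near (0 : R)^'+ => t.
have t0 : 0 < t by near: t; exact: nbhs_right_gt.
have t1 : t <= 1 by near: t; exact: nbhs_right_le.
have : (g x + (dot v (x + t *: (y - x) - x)
     - e / (`|y - x| + 1) * `|x + t *: (y - x) - x|)%:E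
     <= g (x + t *: (y - x))%R)%E by near: t.
rewrite addrAC subrr add0r.
have -> : x + t *: (y - x) = t *: y + (1 - t) *: x.
  by apply: dot_inj => w; rewrite !(dotDr, dotNr, dotZr); ring.
have t01 : 0 <= t <= 1 by rewrite ltW.
move=> /le_trans/(_ (econvex_fin cg t01 (esym (fineK gyf)) (esym (fineK gx)))).
rewrite -{1}(fineK gx) -EFinD lee_fin dotZr normrZ gtr0_norm// -/a -/b => ab.
have en : e / (`|y - x| + 1) * `|y - x| <= e.
  rewrite mulrAC ler_pdivrMr// ler_wpM2l// ?lerDl//; exact: ltW.
suff : t * (a + dot v (y - x)) <= t * (b + e) by rewrite ler_pM2l.
have := ler_wpM2l (ltW t0) en; lra.
Unshelve. all: by end_near. Qed.

Lemma conjugate_ge V (T : V -> R) (u v : V) :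
  ((dot u v - T u)%:E <= conjugate (EFin \o T) v)%E.
Proof. by apply: ereal_sup_ubound; exists u. Qed.

Lemma conjugate_gtNy V (T : V -> R) (v : V) :
  (-oo < conjugate (EFin \o T) v)%E.
Proof. exact: lt_le_trans (ltNyr _) (conjugate_ge T 0 v). Qed.

Lemma conjugate_le V (T : V -> R) (v : V) (c : \bar R) :
  (forall u, ((dot u v - T u)%:E <= c)%E) -> (conjugate (EFin \o T) v <= c)%E.
Proof. by move=> uc; apply: ge_ereal_sup => _ [u _ <-]; exact: uc. Qed.

Lemma econvex_conjugate V (T : V -> R) : econvex (conjugate (EFin \o T)).
Proof.
move=> x y t /andP[t0 t1]; apply: conjugate_le => u.
have t1' : 0 <= 1 - t by rewrite subr_ge0.
have -> : dot u (t *: x + (1 - t) *: y) - T u =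
    t * (dot u x - T u) + (1 - t) * (dot u y - T u).
  by rewrite dotDr !dotZr; ring.
rewrite EFinD [in leLHS]EFinM [X in (_ + X <= _)%E]EFinM.
by apply: leeD; apply: lee_wpmul2l; rewrite ?lee_fin//; exact: conjugate_ge.
Qed.

(** Half of the Fenchel-Young equivalence. A subgradient [q] of [T] at [tau] gives the
    value of the conjugate at [q]; testing the subgradient inequality of the conjugate
    at [q] yields the Fenchel equality for [(tau, w)]. *)
Lemma conjugate_subgradient_flip V (T : V -> R) (w tau : V) : convex_on setT T ->
  convex_subgradient (conjugate (EFin \o T)) w tau ->
  convex_subgradient (EFin \o T) tau w.
Proof.
move=> cT [fw wt].
have [q /convex_subgradientE qP] := convex_subgradient_exists tau cT.
have cq : (conjugate (EFin \o T) q <= (dot tau q - T tau)%:E)%E.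
  apply: conjugate_le => u; rewrite lee_fin.
  by have := qP u; rewrite dotBr (dotC q) (dotC q); lra.
have := le_trans (wt q) cq.
rewrite -(fineK fw) -EFinD lee_fin => wq.
apply/convex_subgradientE => u.
have := conjugate_ge T u w; rewrite -(fineK fw) lee_fin.
by move: wq; rewrite !dotBr (dotC w) (dotC w); lra.
Qed.

End ExtendedConvex.

(** * Subgradients of the separable function and of the linearized one *)

Section Chain.
Context {R : realType} {X Y Z : euclideanType R}.
Variables (F : X -> Y) (G : X -> Z) (theta1 : Y -> R) (theta2 : Z -> R).
Variable h : X -> \bar R.

Let conj2 := conjugate (EFin \o theta2).

(** The only part of [f_sep] that is not convex is the bilinear term, whose
    second-order remainder [<u' - u, z' - z>] is [o] of the distance. *)
Lemma f_sep_regular_subdiff y s u z v1 xi tau :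
  convex_subgradient (EFin \o theta1) y v1 -> convex_subgradient h s xi ->
  convex_subgradient conj2 (- z) tau ->
  regular_subdiff (f_sep theta1 theta2 h) (y, s, u, z) (v1, xi, z, u - tau).
Proof.
move=> /convex_subgradientE v1P [hs xiP] [cz tauP]; split.
  by rewrite /f_sep !fin_numD//= hs cz.
move=> e e0.
have : \forall w \near ((y, s, u, z) : eprod (eprod (eprod Y X) Z) Z),
    `|w - ((y, s, u, z) : eprod (eprod (eprod Y X) Z) Z)| <= e.
  by apply: filterS (near_dist _ e0) => w; exact: ltW.
apply: filterS => -[[[y' s'] u'] z']; rewrite /f_sep => small.
set n := `|_ - _| in small *.
have -> : (dot ((v1, xi, z, u - tau) : eprod (eprod (eprod Y X) Z) Z)
   ((y', s', u', z') - ((y, s, u, z) : eprod (eprod (eprod Y X) Z) Z)) =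
   dot v1 (y' - y) + dot xi (s' - s) + dot z (u' - u) + dot (u - tau) (z' - z))%R.
  by [].
have n1 : `|u' - u| <= n.
  exact: le_trans (norm_snd_le ((y', s', u') - (y, s, u) : eprod (eprod Y X) Z))
    (norm_fst_le ((y', s', u', z') - (y, s, u, z) : eprod (eprod (eprod Y X) Z) Z)).
have n2 : `|z' - z| <= n.
  exact: (norm_snd_le ((y', s', u', z') - (y, s, u, z) : eprod (eprod (eprod Y X) Z) Z)).
have bil : - (e * n) <= dot (u' - u) (z' - z).
  have := cauchy_schwarz (u' - u) (z' - z); rewrite ler_norml => /andP[+ _].
  apply: le_trans; rewrite lerN2; apply: le_trans (_ : n * n <= _).
    by rewrite ler_pM.
  by rewrite ler_wpM2r// normr_ge0.
have := tauP (- z'); have := xiP s'; have := v1P y'.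
rewrite -lee_fin -/conj2 -(fineK hs) -(fineK cz) -!EFinD => i1 i2 i3.
apply: (le_trans _ (leeD (leeD (leeD i1 i2) (lexx _)) i3)).
rewrite -!EFinD lee_fin; move: bil.
by rewrite !(dotBr, dotBl, dotNr) (dotC z) (dotC z) (dotC _ z); lra.
Qed.

End Chain.

Section Chain.
Context {R : realType} {X Y Z : euclideanType R}.
Variables (F : X -> Y) (G : X -> Z) (theta1 : Y -> R) (theta2 : Z -> R).
Variable h : X -> \bar R.

Let conj2 := conjugate (EFin \o theta2).
Let Xit := Xi_tilde F G theta1 theta2 h.

Definition triple (x s : X) (z : Z) : eprod (eprod X X) Z := (x, s, z).

Lemma norm_triple_le x s z x' s' z' :
  `|triple x' s' z' - triple x s z| <= `|x' - x| + `|s' - s| + `|z' - z|.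
Proof.
apply: le_trans (norm_eprod_le _) _; rewrite lerD2r.
exact: (norm_eprod_le ((x', s') - (x, s) : eprod X X)).
Qed.

Lemma dot_triple (v w : eprod (eprod X X) Z) :
  dot v w = dot v.1.1 w.1.1 + dot v.1.2 w.1.2 + dot v.2 w.2 :> R.
Proof. by []. Qed.

Lemma Xi_tilde_fin x s z : (forall y, -oo < h y)%E -> Xit (triple x s z) \is a fin_num ->
  h x \is a fin_num /\ conj2 (- z) \is a fin_num.
Proof.
by rewrite /Xit /triple /Xi_tilde !fin_numD => _ /andP[/andP[_ ->] ->].
Qed.

(** For fixed [x] and [s], [Xi_tilde] is convex in [z]: it is the conjugate plus a linear
    function. *)
Lemma Xi_tilde_subgradient_z x s z v : Xit (triple x s z) \is a fin_num ->
  (forall y, -oo < h y)%E -> regular_subdiff Xit (triple x s z) v ->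
  convex_subgradient conj2 (- z) (linearize G x s - v.2).
Proof.
move=> Xf hN [_ gv]; have [hx cz] := Xi_tilde_fin hN Xf.
apply: regular_subdiff_convex; [exact: econvex_conjugate|exact: conjugate_gtNy|].
split=> // e e0.
have [d d0 dP] := near_distP (gv _ e0).
apply: filterS (near_dist (- z) d0) => zt ztz.
have [->|czt] := eqVneq (conj2 zt) +oo%E; first by rewrite leey.
have cztf : conj2 zt \is a fin_num.
  by rewrite fin_numE czt andbT gt_eqF// conjugate_gtNy.
have nw : `|triple x s (- zt) - triple x s z| <= `|zt - - z|.
  apply: le_trans (norm_triple_le _ _ _ _ _ _) _.
  by rewrite !subrr !normr0 !add0r -opprD normrN opprK.
have := dP _ (le_lt_trans nw ztz).
rewrite /Xit /triple /Xi_tilde opprK -/conj2 -(fineK hx) -(fineK cz) -(fineK cztf).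
rewrite -!EFinD !lee_fin -/(triple x s z) -/(triple x s (- zt)).
have -> : dot v (triple x s (- zt) - triple x s z) = dot v.2 (- zt - z).
  by rewrite dot_triple /= !subrr !dot0r !add0r.
have := ler_wpM2l (ltW e0) nw.
rewrite !(dotBr, dotBl, dotNr, dotDr); lra.
Qed.

(** The first-order model of [Xi_tilde] in [(x, s)], with [theta1] and [h] kept convex and
    everything inside them linearized, is minimal at [0]. The model is convex and
    vanishes at [0], so its value at [(d1, d2)] is at least [1 / t] times its value at
    [t (d1, d2)], and the latter is at least [o(t)] by regularity of the subgradient,
    the local Lipschitz continuity of [theta1] and [linearize_ray]. *)
Lemma linearization_nonneg x s z v d1 d2 :
  convex_on setT theta1 -> econvex h -> (forall y, -oo < h y)%E ->
  differentiable F s -> differentiable G s ->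
  differentiable (fderiv F) s -> differentiable (fderiv G) s ->
  regular_subdiff Xit (triple x s z) v -> (h (x + d1)%R < +oo)%E ->
  0 <= theta1 (linearize F x s + (fderiv F s d1 + fderiv (fderiv F) s d2 (x - s)))
      - theta1 (linearize F x s)
    + (fine (h (x + d1)) - fine (h x)
       + dot (fderiv G s d1 + fderiv (fderiv G) s d2 (x - s)) z
       - dot v.1.1 d1 - dot v.1.2 d2).
Proof.
move=> cT ch hN dF dG ddF ddG [Xf gv] hd.
have [hx cz] := Xi_tilde_fin hN Xf.
have hdf : h (x + d1) \is a fin_num by rewrite fin_real ?hN.
set y := linearize F x s in cz hx *; set u := linearize G x s.
set A := (fderiv F s d1 + _); set B := (fderiv G s d1 + _).
have [L L0 LP] := convex_locally_lipschitz y cT.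
apply/ler_addgt0Pr => e e0.
pose d := triple d1 d2 0.
(* [K] collects the three error terms: that of the subgradient, that of
   [theta1] and that of the pairing with [z]. *)
pose K := `|d| + L + `|z| + 1.
have K0 : 0 < K by rewrite /K; have := normr_ge0 d; have := normr_ge0 z; lra.
have [e1 e10 e1K] : exists2 e1, 0 < e1 & e1 * K = e.
  by exists (e / K); rewrite ?divr_gt0// mulfVK// gt_eqF.
have reg := near_ray d (gv _ e10).
near (0 : R)^'+ => t.
have t0 : 0 < t by near: t; exact: nbhs_right_gt.
have t1 : t <= 1 by near: t; exact: nbhs_right_le.
have t01 : 0 <= t <= 1 by rewrite ltW.
have tA : `|t *: A| <= 2^-1.
  rewrite normrZ (gtr0_norm t0).
  have : t <= (2 * (`|A| + 1))^-1.
    by near: t; apply: nbhs_right_le; rewrite invr_gt0 mulr_gt0// ltr_wpDl.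
  have A0 : 0 < `|A| + 1 by rewrite ltr_wpDl.
  move=> /(ler_wpM2r (ltW A0)); rewrite invfM mulfVK ?gt_eqF//.
  by have := ltW t0; rewrite mulrDr mulr1; lra.
have te : e1 * t <= 2^-1.
  have : t <= (2 * e1)^-1.
    by near: t; apply: nbhs_right_le; rewrite invr_gt0 mulr_gt0.
  move=> /(ler_wpM2l (ltW e10)); have -> // : e1 * (2 * e1)^-1 = 2^-1.
  by field; rewrite gt_eqF.
have rF : `|linearize F (x + t *: d1) (s + t *: d2) - y - t *: A| <= e1 * t.
  by near: t; exact: linearize_ray.
have rG : `|linearize G (x + t *: d1) (s + t *: d2) - u - t *: B| <= e1 * t.
  by near: t; exact: linearize_ray.
have : (Xit (triple x s z) + (dot v (triple x s z + t *: d - triple x s z)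
     - e1 * `|triple x s z + t *: d - triple x s z|)%:E
     <= Xit (triple x s z + t *: d)%R)%E by near: t.
have -> : triple x s z + t *: d - triple x s z = t *: d.
  by rewrite addrAC subrr add0r.
have -> : dot v (t *: d) = t * (dot v.1.1 d1 + dot v.1.2 d2).
  by rewrite dotZr dot_triple /= dot0r addr0.
rewrite normrZ (gtr0_norm t0).
have -> : triple x s z + t *: d = triple (x + t *: d1) (s + t *: d2) z.
  rewrite [LHS](_ : _ = triple (x + t *: d1) (s + t *: d2) (z + t *: 0))//.
  by rewrite scaler0 addr0.
rewrite /Xit /triple /Xi_tilde -/y -/u -/conj2.
set y' := linearize F _ _ in rF *; set u' := linearize G _ _ in rG *.
have hc := econvex_fin ch t01 (esym (fineK hdf)) (esym (fineK hx)).
have xd : t *: (x + d1) + (1 - t) *: x = x + t *: d1.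
  by apply: dot_inj => w; rewrite !(dotDr, dotNr, dotZr); ring.
rewrite xd in hc.
have hcf : h (x + t *: d1) \is a fin_num.
  rewrite fin_numE; apply/andP; split; first by rewrite gt_eqF.
  by apply: contraTneq hc => ->; rewrite -ltNge ltry.
rewrite -(fineK hcf) lee_fin in hc.
rewrite -(fineK hcf) -(fineK hx) -(fineK cz) -!EFinD lee_fin => main.
have [_ cTt] := cT (y + A) y _ t01 I I.
have yd : t *: (y + A) + (1 - t) *: y = y + t *: A.
  by apply: dot_inj => w; rewrite !(dotDr, dotNr, dotZr); ring.
rewrite yd in cTt.
have ryA : y' - (y + t *: A) = y' - y - t *: A by rewrite opprD addrA.
have y'y : `|y' - y| <= 1.
  have -> : y' - y = (y' - y - t *: A) + t *: A by rewrite subrK.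
  apply: le_trans (ler_normD _ _) _; lra.
have [_ /(_ (y + t *: A))] := LP _ y'y; rewrite ryA => lip.
have lipe := ler_wpM2l (ltW L0) rF.
have uz : dot (u' - u - t *: B) z <= e1 * t * `|z|.
  by apply: le_trans (dot_le _ _) _; rewrite ler_wpM2r.
rewrite dotBl dotBl dotZl in uz.
set m := _ + (_ - _ + _ - _ - _).
suff : 0 <= t * (m + e) by rewrite pmulr_rge0.
rewrite -e1K /K /m; have := mulr_gt0 e10 t0; lra.
Unshelve. all: by end_near. Qed.

(** Applying [fermat_multiplier] to the model of [linearization_nonneg] produces a
    single multiplier [v1] for both [x] and [s]; this matters because the estimate of the
    [s]-component below relies on [v1] being controlled by the [x]-component. The model
    is linear in the direction of [s], which gives an equality there. *)
Lemma Xi_tilde_chain x s z v :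
  convex_on setT theta1 -> econvex h -> (forall y, -oo < h y)%E ->
  differentiable F s -> differentiable G s ->
  differentiable (fderiv F) s -> differentiable (fderiv G) s ->
  regular_subdiff Xit (triple x s z) v ->
  exists v1 xi tau,
    [/\ convex_subgradient (EFin \o theta1) (linearize F x s) v1,
        convex_subgradient h x xi, convex_subgradient conj2 (- z) tau &
    [/\ v.1.1 = adjoint (fderiv F s) v1 + xi + adjoint (fderiv G s) z,
        forall ds, dot v.1.2 ds = dot v1 (fderiv (fderiv F) s ds (x - s))
                                + dot z (fderiv (fderiv G) s ds (x - s)) &
        v.2 = linearize G x s - tau]].
Proof.
move=> cT ch hN dF dG ddF ddG gv; have [Xf _] := gv.
have [hx cz] := Xi_tilde_fin hN Xf.
set y := linearize F x s.
pose A_ (d : X * X) : Y := fderiv F s d.1 + fderiv (fderiv F) s d.2 (x - s).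
have linA : linear A_.
  by move=> a d d'; rewrite /A_ /= !linearP !(add_lfunE, scale_lfunE);
     apply: dot_inj => w; rewrite !(dotDr, dotZr); ring.
pose A := HB.pack_for {linear (X * X)%type -> Y} A_
  (GRing.isLinear.Build _ _ _ _ _ linA).
pose T y' := theta1 (y + y') - theta1 y.
pose C : set (X * X)%type := [set d | (h (x + d.1)%R < +oo)%E].
pose H (d : X * X) := fine (h (x + d.1)) - fine (h x)
       + dot (fderiv G s d.1 + fderiv (fderiv G) s d.2 (x - s)) z
       - dot v.1.1 d.1 - dot v.1.2 d.2.
have cTy : convex_on setT T.
  move=> y1 y2 t t01 _ _; split=> //.
  have [_] := cT (y + y1) (y + y2) _ t01 I I.
  have -> : t *: (y + y1) + (1 - t) *: (y + y2) =
      y + (t *: y1 + (1 - t) *: y2).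
    by apply: dot_inj => w; rewrite !(dotDr, dotNr, dotZr); ring.
  by rewrite /T; lra.
have cH : convex_on C H.
  move=> d d' t t01 Cd Cd'.
  have fd : h (x + d.1) \is a fin_num by rewrite fin_real ?hN.
  have fd' : h (x + d'.1) \is a fin_num by rewrite fin_real ?hN.
  have := econvex_fin ch t01 (esym (fineK fd)) (esym (fineK fd')).
  have -> : t *: (x + d.1) + (1 - t) *: (x + d'.1) =
     x + (t *: d + (1 - t) *: d').1.
    by apply: dot_inj => w; rewrite /= !(dotDr, dotNr, dotZr); ring.
  move=> hdd; have Cdd : C (t *: d + (1 - t) *: d').
    exact: le_lt_trans hdd (ltry _).
  split=> //.
  have fdd : h (x + (t *: d + (1 - t) *: d').1) \is a fin_num.
    by rewrite fin_real ?hN.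
  move: hdd; rewrite -(fineK fdd) lee_fin /H => hdd.
  rewrite /= !(linearD, linearZ)/= !(add_lfunE, scale_lfunE).
  by rewrite !(dotDr, dotDl, dotZr, dotZl); lra.
have T0 : T 0 = 0 by rewrite /T addr0 subrr.
have C0 : C 0 by rewrite /C /= addr0 -(fineK hx) ltry.
have H0 : H 0 = 0.
  rewrite /H /= addr0 subrr !linear0 lfunE/= !(addr0, dot0l, dot0r) ; lra.
have [|v1 [v1T v1H]] := fermat_multiplier (A := A) cTy T0 cH C0 H0.
  by move=> d Cd; exact: linearization_nonneg.
exists v1, (v.1.1 - adjoint (fderiv F s) v1 - adjoint (fderiv G s) z),
  (linearize G x s - v.2); split.
- apply/convex_subgradientE => y'; have := v1T (y' - y).
  by rewrite /T subrKC; lra.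
- split=> // x'; have [->|hx'] := eqVneq (h x') +oo%E; first by rewrite leey.
  have hx'f : h x' \is a fin_num by rewrite fin_numE hx' andbT gt_eqF.
  have := v1H (x' - x, 0).
  rewrite /C /= subrKC ltey hx' => /(_ isT).
  rewrite /H /A /A_ /= subrKC !linear0 !zero_lfunE !addr0 dot0r subr0.
  rewrite -(fineK hx) -(fineK hx'f) -EFinD lee_fin.
  rewrite dotBl dotBl (dotC (adjoint _ _)) -adjointP (dotC (adjoint _ _)) -adjointP.
  by rewrite (dotC v1); lra.
- exact: Xi_tilde_subgradient_z.
split.
- by rewrite -addrA subrK subrKC.
- move=> ds.
  have := v1H (0, ds); have := v1H (0, - ds).
  rewrite /C /= addr0 -(fineK hx) ltry => /(_ isT) + /(_ isT).
  rewrite /H /A /A_ /= addr0 subrr !linear0 !(dot0l, dot0r, add0r, sub0r) linearN/=.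
  rewrite (linearN (fderiv (fderiv G) s)) !opp_lfunE !dotNr dotNl (dotC _ z).
  lra.
- by rewrite opprB subrKC.
Qed.

End Chain.

(** * Limits in Euclidean spaces *)

Section LimitsEuclidean.
Context {R : realType}.
Implicit Types U V : euclideanType R.

(** [b (ak t) (vk t) - b a v] splits into [b (ak t - a) (vk t)] and [b a (vk t - v)]. *)
Lemma cvg_bounded_biadditive (T : Type) (Fi : set_system T) {FF : Filter Fi}
    (U V : euclideanType R) (W : normedModType R) (b : U -> V -> W) (C : R)
    (ak : T -> U) (vk : T -> V) (a : U) (v : V) :
  (forall a a' v, b (a - a') v = b a v - b a' v) ->
  (forall a v v', b a (v - v') = b a v - b a v') ->
  (forall a v, `|b a v| <= C * `|a| * `|v|) ->
  ak @ Fi --> a -> vk @ Fi --> v -> b (ak t) (vk t) @[t --> Fi] --> b a v.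
Proof.
move=> bl br bC ca cv; apply/subr_cvg0.
have split_b t : b (ak t) (vk t) - b a v = b (ak t - a) (vk t) + b a (vk t - v).
  by rewrite bl br addrA subrK.
under eq_cvg do rewrite split_b.
rewrite -(addr0 (0 : W)); apply: cvgD.
  apply: norm_cvg0; apply: (@squeeze_cvgr _ _ _ _ (fun=> 0)
      (fun t => C * `|ak t - a| * `|vk t|)).
  - by apply: nearW => t; rewrite normr_ge0 bC.
  - exact: cvg_cst.
  rewrite -(mul0r `|v|) -{1}(mulr0 C).
  apply: cvgM; last exact: cvg_norm.
  apply: cvgM; first exact: cvg_cst.
  by rewrite -(normr0 U); apply: cvg_norm; apply/subr_cvg0.
apply: norm_cvg0; apply: (@squeeze_cvgr _ _ _ _ (fun=> 0)
      (fun t => C * `|a| * `|vk t - v|)).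
- by apply: nearW => t; rewrite normr_ge0 bC.
- exact: cvg_cst.
rewrite -{1}(mulr0 (C * `|a|)).
apply: cvgM; first exact: cvg_cst.
by rewrite -(normr0 V); apply: cvg_norm; apply/subr_cvg0.
Qed.

Lemma cvg_hom_apply (T : Type) (Fi : set_system T) {FF : Filter Fi} U V
    (Ak : T -> 'Hom(U, V)) (vk : T -> U) (A : 'Hom(U, V)) (v : U) :
  Ak @ Fi --> A -> vk @ Fi --> v -> Ak t (vk t) @[t --> Fi] --> A v.
Proof.
apply: (cvg_bounded_biadditive (b := fun (A : 'Hom(U, V)) v => A v) (C := hom_const U)).
- by move=> B B' w; rewrite add_lfunE opp_lfunE.
- by move=> B w w'; rewrite linearB.
- by move=> B w; exact: norm_hom_le.
Qed.

Lemma cvg_adjoint_apply (T : Type) (Fi : set_system T) {FF : Filter Fi} U V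
    (Ak : T -> 'Hom(U, V)) (vk : T -> V) (A : 'Hom(U, V)) (v : V) :
  Ak @ Fi --> A -> vk @ Fi --> v ->
  adjoint (Ak t) (vk t) @[t --> Fi] --> adjoint A v.
Proof.
apply: (cvg_bounded_biadditive (b := fun (A : 'Hom(U, V)) v => adjoint A v)
  (C := hom_const U)).
- by move=> B B' w; rewrite adjointB.
- by move=> B w w'; rewrite linearB.
- by move=> B w; exact: norm_adjoint_le.
Qed.

Lemma cvg_dot (T : Type) (Fi : set_system T) {FF : Filter Fi} V
    (uk vk : T -> V) (u v : V) :
  uk @ Fi --> u -> vk @ Fi --> v -> (dot (uk t) (vk t) : R) @[t --> Fi] --> (dot u v : R).
Proof.
apply: (@cvg_bounded_biadditive _ _ _ V V R^o (fun u v => dot u v) 1).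
- by move=> w w' y; rewrite dotBl.
- by move=> w y y'; rewrite dotBr.
- by move=> w y; rewrite mul1r; exact: cauchy_schwarz.
Qed.

Lemma cvg_linearize (T : Type) (Fi : set_system T) {FF : Filter Fi} U V
    (f : U -> V) (xk sk : T -> U) (x s : U) :
  xk @ Fi --> x -> sk @ Fi --> s -> {for s, continuous f} ->
  {for s, continuous (fderiv f)} ->
  linearize f (xk t) (sk t) @[t --> Fi] --> linearize f x s.
Proof.
move=> cx cs cf cdf; apply: cvgD; first exact: (cvg_comp _ _ cs cf).
apply: cvg_hom_apply; first exact: (cvg_comp _ _ cs cdf).
exact: cvgB.
Qed.

Lemma cvg_fst_eprod (T : Type) (Fi : set_system T) {FF : Filter Fi} U V
    (wk : T -> eprod U V) (w : eprod U V) :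
  wk @ Fi --> w -> (wk t).1 @[t --> Fi] --> w.1.
Proof.
move=> /cvgrPdist_lt cw; apply/cvgrPdist_lt => e e0.
by apply: filterS (cw _ e0) => t; apply: le_lt_trans (norm_fst_le (w - wk t)).
Qed.

Lemma cvg_snd_eprod (T : Type) (Fi : set_system T) {FF : Filter Fi} U V
    (wk : T -> eprod U V) (w : eprod U V) :
  wk @ Fi --> w -> (wk t).2 @[t --> Fi] --> w.2.
Proof.
move=> /cvgrPdist_lt cw; apply/cvgrPdist_lt => e e0.
by apply: filterS (cw _ e0) => t; apply: le_lt_trans (norm_snd_le (w - wk t)).
Qed.

Lemma cvg_harmonic_dist V (a : nat -> V) (l : V) :
  (forall n, `|a n - l| <= n.+1%:R^-1) -> a @ \oo --> l.
Proof.
move=> al; apply/subr_cvg0; apply: norm_cvg0.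
apply: (@squeeze_cvgr _ _ _ _ (fun=> 0) harmonic); last exact: cvg_harmonic.
  by apply: nearW => n; rewrite normr_ge0 al.
exact: cvg_cst.
Qed.

(** Relative continuity turns convergence of points of the domain into [h]-attentive
    convergence. *)
Lemma within_edom_cvg V (T : Type) (Fi : set_system T) {FF : Filter Fi}
    (h : V -> \bar R) (x : V) (xk : T -> V) :
  {within edom h, continuous h} -> edom h x -> (forall t, edom h (xk t)) ->
  xk @ Fi --> x -> h \o xk @ Fi --> h x.
Proof.
move=> ch hx hk cx P hP.
have : within (edom h) (nbhs x) (h @^-1` P).
  by rewrite nbhs_subspace_in//; exact: (ch x P hP).
move=> /cx hxk; have hxk' : Fi [set t | edom h (xk t) -> P (h (xk t))] by exact: hxk.
suff : Fi [set t | P (h (xk t))] by [].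
by apply: filterS hxk' => t /(_ (hk t)).
Qed.

End LimitsEuclidean.

(** * The qualification condition bounds the multipliers *)

Section MultiplierBound.
Context {R : realType} {X Y Z : euclideanType R}.
Variables (F : X -> Y) (G : X -> Z) (theta1 : Y -> R) (theta2 : Z -> R).
Variables (h : X -> \bar R) (xbar : X).
Hypothesis ch : {within edom h, continuous h}.
Hypothesis hx : edom h xbar.
Hypothesis cF : {for xbar, continuous F}.
Hypothesis cG : {for xbar, continuous G}.
Hypothesis cdF : {for xbar, continuous (fderiv F)}.
Hypothesis cdG : {for xbar, continuous (fderiv G)}.
Hypothesis qualification :
  grad_kernel F G xbar `&` limsup_cone F G theta1 theta2 h xbar = [set (0, 0, 0)].

(** Otherwise there are multipliers at points tending to [xbar] for which the left-hand
    side is negligible with respect to their size. After normalization, a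
    subsequence converges to a triple of total norm [1] that lies in the kernel and in
    the three outer limits, against the qualification. Besides the norm estimate, this
    says that the multipliers tend to [0] with their combination, which drives the
    treatment of the [s]-component. The constraint on [linearize G x s - tau] forces the
    base points [tau] of the third outer limit to converge to [G xbar]. *)
Lemma multiplier_bound : exists2 k : R, 0 < k & forall x s z v xi tau,
  `|x - xbar| <= k -> `|s - xbar| <= k -> `|linearize G x s - tau| <= k ->
  convex_subgradient (EFin \o theta1) (linearize F x s) v ->
  convex_subgradient h x xi ->
  convex_subgradient (EFin \o theta2) tau (- z) ->
  k * (`|v| + `|xi| + `|z|) <=
    `|adjoint (fderiv F s) v + xi + adjoint (fderiv G s) z|.
Proof.
apply: contrapT => nex.
have bad n : exists d : X * X * Z * (Y * X * Z), let: (x, s, tau, (v, xi, z)) := d in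
  [/\ `|x - xbar| <= n.+1%:R^-1, `|s - xbar| <= n.+1%:R^-1,
      `|linearize G x s - tau| <= n.+1%:R^-1 &
  [/\ convex_subgradient (EFin \o theta1) (linearize F x s) v,
      convex_subgradient h x xi,
      convex_subgradient (EFin \o theta2) tau (- z) &
      `|adjoint (fderiv F s) v + xi + adjoint (fderiv G s) z|
        < n.+1%:R^-1 * (`|v| + `|xi| + `|z|)]].
  apply: contrapT => nd; apply: nex; exists n.+1%:R^-1; first by rewrite invr_gt0.
  move=> x s z v xi tau xn sn tn hv hxi hz; rewrite leNgt; apply/negP => lt.
  by apply: nd; exists (x, s, tau, (v, xi, z)).
have [d dP] := choice bad.
pose xk n := (d n).1.1.1; pose sk n := (d n).1.1.2; pose tk n := (d n).1.2.
pose vk n := (d n).2.1.1; pose xik n := (d n).2.1.2; pose zk n := (d n).2.2.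
pose N n := `|vk n| + `|xik n| + `|zk n|.
have {}dP n : [/\ `|xk n - xbar| <= n.+1%:R^-1, `|sk n - xbar| <= n.+1%:R^-1,
      `|linearize G (xk n) (sk n) - tk n| <= n.+1%:R^-1 &
  [/\ convex_subgradient (EFin \o theta1) (linearize F (xk n) (sk n)) (vk n),
      convex_subgradient h (xk n) (xik n),
      convex_subgradient (EFin \o theta2) (tk n) (- zk n) &
      `|adjoint (fderiv F (sk n)) (vk n) + xik n + adjoint (fderiv G (sk n)) (zk n)|
        < n.+1%:R^-1 * N n]].
  by have := dP n; rewrite /N /xk /sk /tk /vk /xik /zk; case: (d n) => [[[? ?] ?] [[? ?] ?]].
have N0 n : 0 < N n.
  have [_ _ _ [_ _ _ lt]] := dP n.
  have := le_lt_trans (normr_ge0 _) lt; rewrite pmulr_rgt0// invr_gt0//.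
have Ni n : 0 <= (N n)^-1 by rewrite invr_ge0 ltW.
have cx : xk @ \oo --> xbar by apply: cvg_harmonic_dist => n; have [] := dP n.
have cs : sk @ \oo --> xbar by apply: cvg_harmonic_dist => n; have [] := dP n.
have clG : linearize G (xk n) (sk n) @[n --> \oo] --> linearize G xbar xbar.
  exact: cvg_linearize.
have clF : linearize F (xk n) (sk n) @[n --> \oo] --> linearize F xbar xbar.
  exact: cvg_linearize.
rewrite linearize_self in clG; rewrite linearize_self in clF.
have ct : tk @ \oo --> G xbar.
  have c0 : (fun n => linearize G (xk n) (sk n) - tk n) @ \oo --> (0 : Z).
    by apply: cvg_harmonic_dist => n; rewrite subr0; have [] := dP n.
  rewrite -[G xbar]subr0.
  have -> : tk = fun n => linearize G (xk n) (sk n) - (linearize G (xk n) (sk n) - tk n).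
    by apply/funext => n; rewrite opprB subrKC.
  exact: cvgB.
pose wk n : eprod (eprod Y X) Z :=
  ((N n)^-1 *: vk n, (N n)^-1 *: xik n, (N n)^-1 *: zk n).
have sum1 n : `|(wk n).1.1| + `|(wk n).1.2| + `|(wk n).2| = 1.
  rewrite /wk /= !normrZ !(ger0_norm (Ni n)) -!mulrDr -/(N n) mulVf//.
  by rewrite gt_eqF.
have wb n : `|wk n| <= 1.
  rewrite -(sum1 n); apply: le_trans (norm_eprod_le _) _; rewrite lerD2r.
  exact: (norm_eprod_le (wk n).1).
have [f fi [l wl]] := bounded_cvg_subseq wb.
have fo := increasing_seq_cvg fi.
have wl1 : (wk (f n)).1 @[n --> \oo] --> l.1 by exact: cvg_fst_eprod.
have wl2 : (wk (f n)).2 @[n --> \oo] --> l.2 by exact: cvg_snd_eprod.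
have wl11 : (wk (f n)).1.1 @[n --> \oo] --> l.1.1 by exact: cvg_fst_eprod.
have wl12 : (wk (f n)).1.2 @[n --> \oo] --> l.1.2 by exact: cvg_snd_eprod.
have l1 : `|l.1.1| + `|l.1.2| + `|l.2| = 1.
  have c1 : `|(wk (f n)).1.1| + `|(wk (f n)).1.2| + `|(wk (f n)).2| @[n --> \oo]
      --> `|l.1.1| + `|l.1.2| + `|l.2|.
    by apply: cvgD; [apply: cvgD|]; apply: cvg_norm.
  move: c1; under eq_cvg do rewrite sum1.
  by move=> c1; apply: (norm_cvg_unique c1); exact: cvg_cst.
have ker : grad_kernel F G xbar (l.1.1, l.1.2, l.2).
  rewrite /grad_kernel /=.
  have csf : sk \o f @ \oo --> xbar by exact: (cvg_comp _ _ fo cs).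
  have ck : (fun n => adjoint (fderiv F (sk (f n))) (wk (f n)).1.1 + (wk (f n)).1.2
      + adjoint (fderiv G (sk (f n))) (wk (f n)).2) @ \oo -->
      adjoint (fderiv F xbar) l.1.1 + l.1.2 + adjoint (fderiv G xbar) l.2.
    apply: cvgD; first apply: cvgD => //.
      by apply: cvg_adjoint_apply wl11; exact: (cvg_comp _ _ csf cdF).
    by apply: cvg_adjoint_apply wl2; exact: (cvg_comp _ _ csf cdG).
  apply: (norm_cvg_unique ck).
  apply: (cvg_comp _ _ fo (_ : (fun n => adjoint (fderiv F (sk n)) (wk n).1.1 + (wk n).1.2
      + adjoint (fderiv G (sk n)) (wk n).2) @ \oo --> 0)).
  apply: cvg_harmonic_dist => n; rewrite subr0 /wk /= !linearZ/= -!scalerDr.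
  rewrite normrZ (ger0_norm (Ni n)) mulrC ler_pdivrMr//.
  by have [_ _ _ [_ _ _ /ltW]] := dP n.
have lim : limsup_cone F G theta1 theta2 h xbar (l.1.1, l.1.2, l.2).
  split; first split => /=.
  - exists (fun n => linearize F (xk (f n)) (sk (f n))), (fun n => (wk (f n)).1.1).
    split=> //; first exact: (cvg_comp _ _ fo clF).
    move=> n; exists (N (f n))^-1, (vk (f n)); split=> //.
    have [_ _ _ [sub _ _ _]] := dP (f n).
    exact/regular_subdiffW/convex_subgradient_regular.
  - exists (xk \o f), (fun n => (wk (f n)).1.2); split=> //.
      have cxf : xk \o f @ \oo --> xbar by exact: (cvg_comp _ _ fo cx).
      split=> //; apply: within_edom_cvg => // n.
      have [_ _ _ [_ [hf _] _ _]] := dP (f n).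
      by rewrite /edom /= -(fineK hf) ltry.
    move=> n; exists (N (f n))^-1, (xik (f n)); split=> //.
    have [_ _ _ [_ sub _ _]] := dP (f n).
    exact/regular_subdiffW/convex_subgradient_regular.
  - exists (tk \o f), (fun n => (wk (f n)).2); split=> //.
      exact: (cvg_comp _ _ fo ct).
    move=> n; exists (N (f n))^-1, (zk (f n)); split=> //.
    exists (- zk (f n)); last by rewrite opprK.
    have [_ _ _ [_ _ sub _]] := dP (f n).
    exact/regular_subdiffW/convex_subgradient_regular.
have : [set (0, 0, 0)] (l.1.1, l.1.2, l.2) by rewrite -qualification.
move=> [e1 e2 e3]; move: l1; rewrite e1 e2 e3 !normr0 !addr0 => /eqP.
by rewrite eq_sym oner_eq0.
Qed.

End MultiplierBound.

(** * Lower semicontinuity *)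

Section LowerSemicontinuity.
Context {R : realType}.

Definition lsc_at (T : topologicalType) (g : T -> \bar R) (x : T) :=
  forall a : R, (a%:E < g x)%E -> \forall y \near x, (a%:E < g y)%E.

Lemma lsc_atP (T : topologicalType) (g : T -> \bar R) :
  lower_semicontinuous g <-> forall x, lsc_at g x.
Proof.
split=> [lg x a /lg[N xN NP]|lg x a /lg]; first exact: filterS xN.
by exists [set y | (a%:E < g y)%E].
Qed.

(** Outside [D], the points are isolated in the subspace topology. *)
Lemma lsc_on_open (V : euclideanType R) (D : set V) (g : V -> \bar R) :
  (forall x, D x -> lsc_at g x) -> lsc_on D g.
Proof.
move=> lg; apply/lsc_atP.
have inside (x : V) a : D x -> (a%:E < g x)%E ->
    within D (nbhs x) [set y | (a%:E < g y)%E].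
  by move=> Dx agx; rewrite /within /=; near=> y => _; near: y; exact: lg.
move=> x a agx; have [Dx|nDx] := pselect (D x).
  by have := inside x a Dx agx; rewrite nbhs_subspace_in.
have : globally [set (x : V)] [set y | (a%:E < g y)%E] by move=> _ ->.
by rewrite (@nbhs_subspace_out V D x nDx) => gx; exact: gx.
Unshelve. all: by end_near. Qed.

Lemma lsc_at_EFin (T : topologicalType) (f : T -> R) (x : T) :
  {for x, continuous f} -> lsc_at (EFin \o f) x.
Proof. by move=> cf a; rewrite lte_fin => /(cvgr_gt _ cf). Qed.

Lemma lsc_at_comp (S T : topologicalType) (f : S -> T) (g : T -> \bar R) (x : S) :
  {for x, continuous f} -> lsc_at g (f x) -> lsc_at (g \o f) x.
Proof. by move=> cf lg a /lg /cf. Qed.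

Lemma lsc_at_add (T : topologicalType) (g1 g2 : T -> \bar R) (x : T) :
  (-oo < g1 x)%E -> (-oo < g2 x)%E -> lsc_at g1 x -> lsc_at g2 x ->
  lsc_at (fun y => g1 y + g2 y)%E x.
Proof.
move=> g1N g2N l1 l2 a ag.
have [b [b1 b2]] : exists b, (b%:E < g1 x)%E /\ ((a - b)%:E < g2 x)%E.
  move: g1N g2N ag; case: (g1 x) => [r| |]//; case: (g2 x) => [q| |]// _ _.
  - rewrite -EFinD lte_fin => arq; exists (r - (r + q - a) / 2).
    by rewrite !lte_fin; split; lra.
  - by move=> _; exists (r - 1); rewrite lte_fin ltry; split=> //; lra.
  - move=> _; exists (a - (q - 1)); rewrite lte_fin ltry; split=> //; lra.
  - by move=> _; exists 0; rewrite !ltry.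
apply: filterS2 (l1 _ b1) (l2 _ b2) => y c1 c2.
by have := lteD c1 c2; rewrite -EFinD addrC subrK.
Qed.

Lemma lsc_at_conjugate (V : euclideanType R) (T : V -> R) (v : V) :
  lsc_at (conjugate (EFin \o T)) v.
Proof.
move=> a /ereal_sup_gt[_ [u _ <-]] /=; rewrite -EFinB lte_fin => au.
have cu : {for v, continuous (fun v' => dot u v' - T u)}.
  apply: cvgB; last exact: cvg_cst.
  by apply: cvg_dot; [exact: cvg_cst|exact: cvg_id].
apply: filterS (cvgr_gt _ cu _ au) => v' av'.
by apply: lt_le_trans (conjugate_ge T u v'); rewrite lte_fin.
Qed.

End LowerSemicontinuity.

Section Standing.
Context {R : realType} {X Y Z : euclideanType R}.
Variables (F : X -> Y) (G : X -> Z) (theta1 : Y -> R) (theta2 : Z -> R).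
Variables (h : X -> \bar R) (O : set X).
Hypothesis assumptions : standing_assumptions F G theta1 theta2 h O.

Let conj2 := conjugate (EFin \o theta2).
Let Xit := Xi_tilde F G theta1 theta2 h.

Lemma gtNy_h x : (-oo < h x)%E.
Proof. by have [hN _] := sa_proper assumptions; exact: hN. Qed.

Lemma strictly_continuous_continuous (W : euclideanType R) (f : X -> W) x :
  strictly_continuous_on O f -> O x -> {for x, continuous f}.
Proof.
move=> lipf Ox; have [N xN [k0 [k0r]]] := lipf x Ox.
pose k := Num.max 1 (k0 + 1) => /(_ k).
have k00 : k0 < k by rewrite lt_max ltrDl ltr01 orbT.
have k1 : 0 < k by rewrite lt_max ltr01.
move=> /(_ k00) lf; apply/cvgrPdist_lt => e e0.
have ek : 0 < e / k by rewrite divr_gt0.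
have Nx := nbhs_singleton xN.
apply: filterS2 xN (near_dist x ek) => y Ny yx.
have := lf (x, y) (conj Nx Ny); rewrite /= => lfxy.
apply: le_lt_trans lfxy _; rewrite distrC in yx.
by rewrite mulrC -ltr_pdivlMr.
Qed.

Lemma cvg_triple (w : eprod (eprod X X) Z) :
  [/\ (w'.1.1 : X) @[w' --> w] --> w.1.1,
      (w'.1.2 : X) @[w' --> w] --> w.1.2 & (w'.2 : Z) @[w' --> w] --> w.2].
Proof.
have c0 : id w' @[w' --> w] --> w by exact: cvg_id.
have c1 : w'.1 @[w' --> w] --> w.1 by exact: (cvg_fst_eprod c0).
by split; [exact: (cvg_fst_eprod c1)|exact: (cvg_snd_eprod c1)|exact: (cvg_snd_eprod c0)].
Qed.

Lemma cvg_linearize_triple (W : euclideanType R) (f : X -> W)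
    (w : eprod (eprod X X) Z) :
  (forall x, O x -> differentiable f x) -> strictly_continuous_on O (fderiv f) ->
  O w.1.2 -> linearize f w'.1.1 w'.1.2 @[w' --> w] --> linearize f w.1.1 w.1.2.
Proof.
move=> df lf Ow; have [c1 c2 _] := cvg_triple w.
apply: cvg_linearize c1 c2 _ _.
  by apply: differentiable_continuous; exact: df.
exact: strictly_continuous_continuous lf Ow.
Qed.

Lemma Xi_tilde_gtNy w : (-oo < Xit w)%E.
Proof.
case: w => [[x s] z]; rewrite /Xit /Xi_tilde -EFinD.
have := gtNy_h x; have := conjugate_gtNy theta2 (- z).
by case: (conjugate _ _) => [r| |]// _; case: (h x) => [q| |]//= _; rewrite ?ltNyr.
Qed.

(** A continuous function plus two lower semicontinuous ones, none of which takes the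
    value [-oo]. *)
Lemma Xi_tilde_lsc_at (w : eprod (eprod X X) Z) : O w.1.2 -> lsc_at Xit w.
Proof.
move=> Ow.
have [c1 c2 c3] := cvg_triple w.
pose smooth_part (w : eprod (eprod X X) Z) : R :=
  theta1 (linearize F w.1.1 w.1.2) + dot (linearize G w.1.1 w.1.2) w.2.
have -> : Xit = (fun w => (EFin \o smooth_part) w + (h \o (fun w => w.1.1)) w
     + (conj2 \o (fun w => - w.2)%R) w)%E.
  by apply/funext => -[[x s] z]; rewrite /Xit /Xi_tilde /= EFinD.
apply: lsc_at_add; rewrite ?conjugate_gtNy//.
- by rewrite /=; have := gtNy_h w.1.1; case: (h _) => //= r _; exact: ltNyr.
- apply: lsc_at_add; rewrite ?gtNy_h//; first exact: ltNyr.
  have cF : linearize F w'.1.1 w'.1.2 @[w' --> w] --> linearize F w.1.1 w.1.2.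
    exact: cvg_linearize_triple (sa_diffF assumptions) (sa_lipF assumptions) Ow.
  have cG : linearize G w'.1.1 w'.1.2 @[w' --> w] --> linearize G w.1.1 w.1.2.
    exact: cvg_linearize_triple (sa_diffG assumptions) (sa_lipG assumptions) Ow.
  have cT : {for linearize F w.1.1 w.1.2, continuous theta1}.
    by apply: convex_continuous; exact/convex_function_on/(sa_convex1 assumptions).
  have c4 : (theta1 (linearize F w'.1.1 w'.1.2) : R^o) @[w' --> w] -->
      (theta1 (linearize F w.1.1 w.1.2) : R^o) by exact: (cvg_comp _ _ cF cT).
  have c5 : (dot (linearize G w'.1.1 w'.1.2) w'.2 : R^o) @[w' --> w] -->
      (dot (linearize G w.1.1 w.1.2) w.2 : R^o) by exact: cvg_dot cG c3.
  apply: (lsc_at_EFin (f := smooth_part)).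
  exact: (cvgD c4 c5).
  apply: lsc_at_comp; first exact: c1.
  by have /lsc_atP := sa_lsc assumptions.
- apply: lsc_at_comp; last exact: lsc_at_conjugate.
  exact: cvgN c3.
Qed.

End Standing.

(** * The KL property of the linearized function *)

Section Qualified.
Context {R : realType} {X Y Z : euclideanType R}.
Variables (F : X -> Y) (G : X -> Z) (theta1 : Y -> R) (theta2 : Z -> R).
Variables (h : X -> \bar R) (O : set X).
Hypothesis assumptions : standing_assumptions F G theta1 theta2 h O.
Variables (xbar : X) (zbar : Z).
Hypothesis critical : subdiff (Xi_tilde F G theta1 theta2 h) (xbar, xbar, zbar) 0.
Hypothesis C1F' : C1_near xbar (fderiv F).
Hypothesis C1G' : C1_near xbar (fderiv G).
Variables (p : R).
Hypothesis p01 : 0 <= p < 1.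
Hypothesis KLf : KL_property setT (f_sep theta1 theta2 h) p
             (F xbar, xbar, G xbar, zbar).
Hypothesis qualification :
       grad_kernel F G xbar `&` limsup_cone F G theta1 theta2 h xbar
       = [set (0, 0, 0)].

Let Xit := Xi_tilde F G theta1 theta2 h.
Let wbar : eprod (eprod X X) Z := triple xbar xbar zbar.

Lemma f_sep_Xi_tilde x s z :
  f_sep theta1 theta2 h (linearize F x s, x, linearize G x s, z) = Xit (triple x s z).
Proof. by rewrite /f_sep /Xit /Xi_tilde /triple; congr (_ + _)%E; exact: addeAC. Qed.

Lemma Xi_tilde_bar_fin : Xit wbar \is a fin_num.
Proof. by have [] := critical. Qed.

Lemma edom_xbar : edom h xbar.
Proof.
have [hf _] := Xi_tilde_fin (gtNy_h assumptions) Xi_tilde_bar_fin.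
by rewrite /edom /= -(fineK hf) ltry.
Qed.

Lemma O_xbar : O xbar.
Proof. exact: (sa_dom assumptions) edom_xbar. Qed.

Lemma norm_second_derivative_le (W : euclideanType R) (f : X -> W) (s ds d : X) (M : R) :
  `|fderiv (fderiv f) s| <= M ->
  `|fderiv (fderiv f) s ds d| <= hom_const X ^+ 2 * M * `|ds| * `|d|.
Proof.
move=> fM; have c0 := ltW (@hom_const_gt0 R X).
apply: le_trans (norm_hom_le _ _) _; rewrite ler_wpM2r//.
rewrite expr2 -!mulrA ler_wpM2l//.
by apply: le_trans (norm_hom_le _ _) _; rewrite mulrA ler_wpM2r// ler_wpM2l.
Qed.

Lemma C1_near_bound (W : euclideanType R) (f : X -> W) : C1_near xbar (fderiv f) ->
  \forall s \near xbar, differentiable (fderiv f) s /\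
    `|fderiv (fderiv f) s| <= `|fderiv (fderiv f) xbar| + 1.
Proof.
move=> C1; have [_ cf] := nbhs_singleton C1.
have c1 : \forall s \near xbar, `|fderiv (fderiv f) s - fderiv (fderiv f) xbar| < 1.
  by apply: cvgr_distC_lt => //; exact: cf.
apply: filterS2 C1 c1 => s [df _] s1; split=> //.
rewrite -[X in `|X|](subrK (fderiv (fderiv f) xbar)) addrC.
by apply: le_trans (ler_normD _ _) _; rewrite lerD2l ltW.
Qed.

(** The components of the multipliers that act on [s] carry a factor [x - s]. *)
Lemma second_order_part_le x s vs v1 z M :
  `|fderiv (fderiv F) s| <= M -> `|fderiv (fderiv G) s| <= M ->
  (forall ds, dot vs ds = dot v1 (fderiv (fderiv F) s ds (x - s))
                        + dot z (fderiv (fderiv G) s ds (x - s))) ->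
  `|vs| <= hom_const X ^+ 2 * M * `|x - s| * (`|v1| + `|z|).
Proof.
move=> FM GM vsE; have [->|v0] := eqVneq `|vs| 0.
  by rewrite !mulr_ge0 ?exprn_ge0 ?addr_ge0// ?(le_trans _ FM)// ltW ?hom_const_gt0.
have vp : 0 < `|vs| by rewrite lt_neqAle eq_sym v0/=.
rewrite -(ler_pM2l vp) -expr2 -dot_norm vsE.
apply: le_trans (lerD (dot_le _ _) (dot_le _ _)) _.
have a1 := ler_wpM2l (normr_ge0 v1) (norm_second_derivative_le vs (x - s) FM).
have a2 := ler_wpM2l (normr_ge0 z) (norm_second_derivative_le vs (x - s) GM).
apply: le_trans (lerD a1 a2) _; lra.
Qed.

(** A regular subgradient [v] of [Xi_tilde] at [w] produces, by [Xi_tilde_chain], the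
    subgradient [zeta] of [f_sep] at the point where [f_sep] takes the value of
    [Xi_tilde] at [w]. When [v] is small, [multiplier_bound] gives [`|zeta| <= C `|v|],
    so that the KL inequality of [f_sep] passes to [Xi_tilde]. The same bound shows that
    the [s]-component of [v] is small with respect to its [x]-component. *)
Lemma local_estimate : exists c eta del M : R, [/\ 0 < c, 0 < eta, 0 < del, 0 < M &
  \forall w \near wbar, forall v, `|v| < del -> regular_subdiff Xit w v ->
    (forall b, Xit w = b%:E -> 0 < b - fine (Xit wbar) < eta ->
       c * (b - fine (Xit wbar)) `^ p <= `|v|) /\
    `|v.1.2| <= M * `|w.1.1 - w.1.2| * `|v.1.1| ].
Proof.
have Ox := O_xbar.
have cT1 := convex_function_on (sa_convex1 assumptions).
have cT2 := convex_function_on (sa_convex2 assumptions).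
have diff_cont (W : euclideanType R) (f : X -> W) x : differentiable f x ->
    {for x, continuous f} by move=> df; exact: differentiable_continuous.
have cdF := strictly_continuous_continuous (sa_lipF assumptions) Ox.
have cdG := strictly_continuous_continuous (sa_lipG assumptions) Ox.
have [k k0 kP] := multiplier_bound (sa_conth assumptions) edom_xbar
  (diff_cont _ _ _ (sa_diffF assumptions Ox)) (diff_cont _ _ _ (sa_diffG assumptions Ox))
  cdF cdG qualification.
have [c0 [eta [c00 eta0 fKL]]] := KL_lower_bound p01 KLf.
have [d d0 dP] := near_distP fKL.
pose M0 := `|fderiv (fderiv F) xbar| + `|fderiv (fderiv G) xbar| + 1.
have M00 : 0 < M0 by rewrite ltr_wpDl// addr_ge0.
have C0 : 0 < hom_const X ^+ 2 * M0 by rewrite mulr_gt0// exprn_gt0// hom_const_gt0.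
have k1 : 0 < k^-1 + 1 by rewrite addr_gt0// invr_gt0.
exists (c0 / (k^-1 + 1)), eta, k, (hom_const X ^+ 2 * M0 / k).
split; rewrite ?divr_gt0//.
have [c1 c2 c3] := cvg_triple wbar.
have cF := cvg_linearize_triple (sa_diffF assumptions) (sa_lipF assumptions) (Ox : O wbar.1.2).
have cG := cvg_linearize_triple (sa_diffG assumptions) (sa_lipG assumptions) (Ox : O wbar.1.2).
rewrite /= linearize_self in cF; rewrite /= linearize_self in cG.
have d4 : 0 < d / 4 by rewrite divr_gt0.
have dO : \forall s \near xbar, O s.
  by apply: open_nbhs_nbhs; split=> //; exact: sa_open assumptions.
near=> w => v vk gv.
have Ow : O w.1.2 by near: w; exact: c2 _ dO.
have [ddF FM] : differentiable (fderiv F) w.1.2 /\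
    `|fderiv (fderiv F) w.1.2| <= `|fderiv (fderiv F) xbar| + 1.
  by near: w; exact: c2 _ (C1_near_bound C1F').
have [ddG GM] : differentiable (fderiv G) w.1.2 /\
    `|fderiv (fderiv G) w.1.2| <= `|fderiv (fderiv G) xbar| + 1.
  by near: w; exact: c2 _ (C1_near_bound C1G').
have xk : `|w.1.1 - xbar| <= k by near: w; exact: (cvgr_distC_le _ _ c1 _ k0).
have sk : `|w.1.2 - xbar| <= k by near: w; exact: (cvgr_distC_le _ _ c2 _ k0).
have xd : `|w.1.1 - xbar| < d / 4 by near: w; exact: (cvgr_distC_lt _ _ c1 _ d4).
have zd : `|w.2 - zbar| < d / 4 by near: w; exact: (cvgr_distC_lt _ _ c3 _ d4).
have yd : `|linearize F w.1.1 w.1.2 - F xbar| < d / 4.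
  by near: w; exact: (cvgr_distC_lt _ _ cF _ d4).
have ud : `|linearize G w.1.1 w.1.2 - G xbar| < d / 4.
  by near: w; exact: (cvgr_distC_lt _ _ cG _ d4).
have := @Xi_tilde_chain _ _ _ _ F G theta1 theta2 h w.1.1 w.1.2 w.2 v cT1
  (sa_convexh assumptions) (gtNy_h assumptions)
  (sa_diffF assumptions Ow) (sa_diffG assumptions Ow) ddF ddG.
have wE : triple w.1.1 w.1.2 w.2 = w by case: (w) => [[]].
rewrite wE => /(_ gv)[v1 [xi [tau [v1P xiP tauP [vx vs vz]]]]].
have tauk : `|linearize G w.1.1 w.1.2 - tau| <= k.
  by rewrite -vz; apply: le_trans (norm_snd_le v) _; exact: ltW.
have mb := kP _ _ _ _ _ _ xk sk tauk v1P xiP (conjugate_subgradient_flip cT2 tauP).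
rewrite -vx mulrC -ler_pdivlMr// in mb.
have vxv : `|v.1.1| <= `|v| := le_trans (norm_fst_le v.1) (norm_fst_le v).
split=> [b wb bb|]; last first.
  have FM0 : `|fderiv (fderiv F) w.1.2| <= M0.
    by apply: le_trans FM _; rewrite /M0 lerD2r lerDl.
  have GM0 : `|fderiv (fderiv G) w.1.2| <= M0.
    by apply: le_trans GM _; rewrite /M0 lerD2r lerDr.
  apply: le_trans (second_order_part_le FM0 GM0 vs) _.
  have -> : hom_const X ^+ 2 * M0 / k * `|w.1.1 - w.1.2| * `|v.1.1| =
     hom_const X ^+ 2 * M0 * `|w.1.1 - w.1.2| * (`|v.1.1| / k).
    by field; rewrite gt_eqF.
  apply: ler_wpM2l; first by apply: mulr_ge0 => //; exact: ltW.
  by have := normr_ge0 xi; lra.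
pose q : eprod (eprod (eprod Y X) Z) Z :=
  (linearize F w.1.1 w.1.2, w.1.1, linearize G w.1.1 w.1.2, w.2).
pose zeta : eprod (eprod (eprod Y X) Z) Z :=
  (v1, xi, w.2, linearize G w.1.1 w.1.2 - tau).
have fbar : f_sep theta1 theta2 h (F xbar, xbar, G xbar, zbar) = Xit wbar.
  by rewrite -f_sep_Xi_tilde !linearize_self.
have qb : f_sep theta1 theta2 h q = b%:E by rewrite f_sep_Xi_tilde wE.
have qd : `|q - (F xbar, xbar, G xbar, zbar)| < d.
  apply: le_lt_trans (norm_eprod_le _) _.
  apply: le_lt_trans (lerD (norm_eprod_le _) (lexx _)) _.
  apply: le_lt_trans (lerD (lerD (norm_eprod_le _) (lexx _)) (lexx _)) _.
  by move: xd zd yd ud; rewrite /q /=; lra.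
have := dP _ qd b zeta qb; rewrite fbar => /(_ bb).
have qz : subdiff (f_sep theta1 theta2 h) q zeta.
  by apply: regular_subdiffW; exact: f_sep_regular_subdiff.
move=> /(_ qz) zlow.
have zup : `|zeta| <= `|v| / k + `|v|.
  apply: le_trans (norm_eprod_le _) _; apply: lerD; last first.
    by rewrite /zeta /= -vz; exact: norm_snd_le.
  apply: le_trans (norm_eprod_le _) _.
  apply: le_trans (lerD (norm_eprod_le _) (lexx _)) _.
  by apply: le_trans mb _; rewrite ler_wpM2r// invr_ge0 ltW.
rewrite mulrAC ler_pdivrMr//; apply: le_trans zlow _; apply: le_trans zup _; lra.
Unshelve. all: by end_near. Qed.

(** Where the value gap is bounded, the KL inequality holds trivially for the
    subgradients that are bounded away from [0]. *)
Lemma KL_of_small_subgradients (V : euclideanType R) (D : set V) (g : V -> \bar R) (x : V)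
    (c eta del : R) :
  proper_on D g -> lsc_on D g -> D x -> subdiff g x !=set0 ->
  0 < c -> 0 < eta -> 0 < del ->
  (\forall y \near x, forall b v, g y = b%:E -> 0 < b - fine (g x) < eta ->
    `|v| < del ->
    regular_subdiff g y v -> c * (b - fine (g x)) `^ p <= `|v|) ->
  KL_property D g p x.
Proof.
move=> gp gl Dx gs c0 eta0 del0 reg; have /andP[p0 _] := p01.
have e1 : 0 < eta `^ p by exact: powR_gt0.
pose c' := Num.min c (del / eta `^ p).
have c'0 : 0 < c' by rewrite lt_min c0 divr_gt0.
apply: (KL_of_regular p01 gp gl Dx gs c'0 eta0).
apply: filterS reg => y yP b v gyb bb gv.
have bp : 0 <= (b - fine (g x)) `^ p by exact: powR_ge0.
have [vd|vd] := ltP `|v| del.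
  apply: le_trans (yP b v gyb bb vd gv).
  by rewrite ler_wpM2r// /c' ge_min lexx.
apply: le_trans vd; apply: le_trans (_ : del / eta `^ p * (b - fine (g x)) `^ p <= _).
  by rewrite ler_wpM2r// /c' ge_min lexx orbT.
rewrite mulrAC ler_pdivrMr// ler_wpM2l//; first exact: ltW.
case/andP: bb => b1 b2.
by rewrite ge0_ler_powR// ?nnegrE; apply: ltW.
Qed.

Lemma KL_property_Xi_tilde : KL_property [set w : eprod (eprod X X) Z | O w.1.2] Xit p wbar.
Proof.
have [c [eta [del [M [c0 eta0 del0 M0 est]]]]] := local_estimate.
apply: (@KL_of_small_subgradients _ _ _ _ c eta del) => //.
- split; first by move=> w _; exact: Xi_tilde_gtNy assumptions w.
  exists wbar; first exact: O_xbar.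
  by have := Xi_tilde_bar_fin; rewrite /edom /= ltey fin_numE => /andP[].
- by apply: lsc_on_open => w Ow; exact: (Xi_tilde_lsc_at assumptions (w := w) Ow).
- exact: O_xbar.
- by exists 0.
by apply: filterS est => w wP b v wb bb vd /(wP v vd)[+ _]; exact.
Qed.

End Qualified.

(** * Quadratic forms of self-adjoint maps *)

Section QuadraticForms.
Context {R : realType} {X : euclideanType R}.
Implicit Types (Q P : selfadjoint X) (d : X).

Lemma norm_vsval Q : `|Q| = `|vsval Q|.
Proof.
apply/eqP; rewrite -(@eqrXn2 _ 2)// -!dot_norm; exact/eqP.
Qed.

Lemma norm_selfadjoint_le Q d : `|vsval Q d| <= hom_const X * `|Q| * `|d|.
Proof. by rewrite norm_vsval; exact: norm_hom_le. Qed.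

Lemma selfadjoint_dot Q x y : dot (vsval Q x) y = dot x (vsval Q y).
Proof. by have /selfadjointP := subvsP Q; apply. Qed.

Lemma quadform_expansion Q Q' d d' :
  `|quadform Q' d' - quadform Q d - 2 * dot (vsval Q d) (d' - d)
    - dot d (vsval (Q' - Q) d)| <=
  hom_const X * (`|Q| * `|d' - d| ^+ 2 + 2 * `|Q' - Q| * `|d| * `|d' - d|
               + `|Q' - Q| * `|d' - d| ^+ 2).
Proof.
set D := d' - d; set P := Q' - Q.
have dE : d' = d + D by rewrite subrKC.
have QE : Q' = Q + P by rewrite subrKC.
clearbody D P.
have -> : quadform Q' d' - quadform Q d - 2 * dot (vsval Q d) D - dot d (vsval P d)
  = dot D (vsval Q D) + 2 * dot D (vsval P d) + dot D (vsval P D).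
  have vD x : vsval (Q + P) x = vsval Q x + vsval P x.
    by rewrite linearD add_lfunE.
  have vd (P0 : selfadjoint X) : vsval P0 (d + D) = vsval P0 d + vsval P0 D.
    exact: linearD.
  rewrite /quadform dE QE vD !vd.
  have sw (P0 : selfadjoint X) : dot d (vsval P0 D) = dot D (vsval P0 d).
    by rewrite -selfadjoint_dot dotC.
  rewrite !(dotDl, dotDr) !sw (dotC (vsval Q d)); ring.
have b (P0 : selfadjoint X) u w : `|dot u (vsval P0 w)| <= hom_const X * `|P0| * `|w| * `|u|.
  apply: le_trans (cauchy_schwarz _ _) _; rewrite mulrC ler_wpM2r//.
  exact: norm_selfadjoint_le.
apply: le_trans (ler_normD _ _) _.
apply: le_trans (lerD (ler_normD _ _) (lexx _)) _.
rewrite normrM (ger0_norm (_ : 0 <= 2))//.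
have b1 := b Q D D; have b2 := b P D d; have b3 := b P D D.
rewrite !expr2; lra.
Qed.

(** [W] represents the rank-one form [d (x) d]: it is the partial gradient with respect to
    [Q] of the quadratic term. *)
Lemma riesz_quadform d :
  exists W : selfadjoint X, (forall P, dot W P = dot d (vsval P d)) /\
    `|W| <= hom_const X * `|d| ^+ 2.
Proof.
have [|W WP] := @riesz R (selfadjoint X) (fun P => dot d (vsval P d)).
  by move=> a P P'; rewrite linearP add_lfunE scale_lfunE dotDr dotZr.
exists W; split=> // ; have [->|n0] := eqVneq `|W| 0.
  by rewrite mulr_ge0 ?exprn_ge0// ltW// hom_const_gt0.
have np : 0 < `|W| by rewrite lt_neqAle eq_sym n0/=.
rewrite -(ler_pM2l np) -expr2 -dot_norm -WP.
apply: le_trans (dot_le _ _) _.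
have := ler_wpM2l (normr_ge0 d) (norm_selfadjoint_le W d); rewrite expr2; lra.
Qed.

(** [Q] is invertible, which gives the estimate for [Q] itself; with twice the
    constant it persists for the maps [Q'] close to [Q]. *)
Lemma positive_definite_coercive Q : positive_definite Q ->
  exists2 c : R, 0 < c & \forall Q' \near Q, forall d,
    `|d| <= c * `|vsval (Q' : selfadjoint X) d|.
Proof.
move=> pd; have ker0 : lker (vsval Q) == 0%VS.
  apply/lker0P => x y Qxy; apply/eqP; rewrite -subr_eq0; apply: contraT => /pd.
  by rewrite /quadform linearB/= Qxy subrr dot0r ltxx.
pose k := hom_const X * `|(vsval Q)^-1%VF| + 1.
have C0 := @hom_const_gt0 R X.
have k0 : 0 < k by rewrite ltr_wpDl// mulr_ge0// ltW.
have kP d : `|d| <= k * `|vsval Q d|.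
  rewrite -{1}(lker0_lfunK ker0 d); apply: le_trans (norm_hom_le _ _) _.
  by rewrite ler_wpM2r// lerDl.
exists (2 * k); first by rewrite mulr_gt0.
have e0 : 0 < (2 * k * hom_const X)^-1 by rewrite invr_gt0 !mulr_gt0.
suff kQ' (Q' : selfadjoint X) d : `|Q' - Q| < (2 * k * hom_const X)^-1 ->
    `|d| <= 2 * k * `|vsval Q' d|.
  by apply: filterS (near_dist Q e0) => Q' Q'Q d; exact: kQ'.
move=> Q'Q.
have : `|vsval Q d| <= `|vsval Q' d| + (2 * k)^-1 * `|d|.
  have -> : vsval Q d = vsval Q' d - vsval (Q' - Q) d.
    by rewrite linearB add_lfunE opp_lfunE opprB subrKC.
  apply: le_trans (ler_normB _ _) _; rewrite lerD2l.
  apply: le_trans (norm_selfadjoint_le _ _) _; rewrite ler_wpM2r//.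
  have := ler_wpM2l (ltW C0) (ltW Q'Q); move=> /le_trans; apply.
  by rewrite le_eqVlt; apply/orP; left; apply/eqP; field; rewrite !gt_eqF.
move=> /(ler_wpM2l (ltW k0)) /(le_trans (kP d)).
have -> : k * (`|vsval Q' d| + (2 * k)^-1 * `|d|) = k * `|vsval Q' d| + `|d| / 2.
  by field; rewrite gt_eqF.
lra.
Qed.

Lemma cvg_selfadjoint_apply (T : Type) (Fi : set_system T) {FF : Filter Fi}
    (Qk : T -> selfadjoint X) (dk : T -> X) Q d :
  Qk @ Fi --> Q -> dk @ Fi --> d -> vsval (Qk t) (dk t) @[t --> Fi] --> vsval Q d.
Proof.
move=> cQ cd; apply: cvg_hom_apply => //.
apply/cvgrPdist_lt => e e0.
by move/cvgrPdist_lt : cQ => /(_ e e0); apply: filterS => t; rewrite norm_vsval linearB.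
Qed.

Lemma cvg_quadform (T : Type) (Fi : set_system T) {FF : Filter Fi}
    (Qk : T -> selfadjoint X) (dk : T -> X) Q d :
  Qk @ Fi --> Q -> dk @ Fi --> d ->
  (quadform (Qk t) (dk t) : R^o) @[t --> Fi] --> (quadform Q d : R^o).
Proof.
by move=> cQ cd; apply: cvg_dot => //; exact: cvg_selfadjoint_apply.
Qed.

Lemma chi_semidefinite_lsc Q : lsc_at (chi (@semidefinite R X)) Q.
Proof.
move=> a; rewrite /chi; case: ifPn => [_ a0|/negP QS _].
  by near=> P; case: ifP => // _; rewrite ltry.
have [d Qd] : exists d, quadform Q d < 0.
  apply: contrapT => nd; apply: QS; rewrite inE => d; rewrite leNgt; apply/negP => Qd.
  by apply: nd; exists d.
have cq : (quadform P d : R^o) @[P --> Q] --> (quadform Q d : R^o).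
  exact: (@cvg_quadform _ (nbhs Q) _ id (fun=> d) Q d cvg_id (cvg_cst d)).
apply: filterS (cvgr_lt _ cq _ Qd) => P Pd.
case: ifPn => [|_]; last by rewrite ltry.
by rewrite inE => /(_ d); rewrite leNgt Pd.
Unshelve. all: by end_near. Qed.

Lemma chi_ge0 (C : set (selfadjoint X)) Q : (0 <= chi C Q)%E.
Proof. by rewrite /chi; case: ifP. Qed.

End QuadraticForms.

(** * Adding the quadratic term to subgradients *)

Section Xi.
Context {R : realType} {X Y Z : euclideanType R}.
Variables (F : X -> Y) (G : X -> Z) (theta1 : Y -> R) (theta2 : Z -> R).
Variable h : X -> \bar R.

Let Xit := Xi_tilde F G theta1 theta2 h.
Let XiQ := Xi F G theta1 theta2 h.
Let S := eprod (eprod (eprod X X) Z) (selfadjoint X).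

(** The gradient of [(x, s, z) |-> quadform Q (x - s)]. *)
Definition quad_grad (Q : selfadjoint X) (w : eprod (eprod X X) Z) : eprod (eprod X X) Z :=
  triple (2 *: vsval Q (w.1.1 - w.1.2)) (- (2 *: vsval Q (w.1.1 - w.1.2))) 0.

Lemma dot_quad_grad Q w (a : eprod (eprod X X) Z) :
  dot (quad_grad Q w) a = 2 * dot (vsval Q (w.1.1 - w.1.2)) (a.1.1 - a.1.2).
Proof. by rewrite dot_triple /= dotNl !dotZl dot0l dotBr; ring. Qed.

Lemma norm_quad_grad_le Q w :
  `|quad_grad Q w| <= 4 * `|vsval Q (w.1.1 - w.1.2)|.
Proof.
apply: le_trans (norm_eprod_le _) _; rewrite /= normr0 addr0.
apply: le_trans (norm_eprod_le _) _; rewrite /= normrN normrZ ger0_norm//; lra.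
Qed.

Lemma XiE w Q : XiQ ((w, Q) : S) =
  (Xit w + (quadform Q (w.1.1 - w.1.2))%:E + chi (@semidefinite R X) Q)%E.
Proof. by case: w => [[x s] z]. Qed.

Lemma norm_gap_le (w w' : eprod (eprod X X) Z) :
  `|(w'.1.1 - w'.1.2) - (w.1.1 - w.1.2)| <= 2 * `|w' - w|.
Proof.
have -> : (w'.1.1 - w'.1.2) - (w.1.1 - w.1.2) = (w' - w).1.1 - (w' - w).1.2.
  by apply: dot_inj => y; rewrite /= !(dotDr, dotNr); ring.
apply: le_trans (ler_normB _ _) _.
have a := le_trans (norm_fst_le (w' - w).1) (norm_fst_le (w' - w)).
have b := le_trans (norm_snd_le (w' - w).1) (norm_fst_le (w' - w)).
lra.
Qed.

Lemma quad_remainder_le (w w' : eprod (eprod X X) Z) (Q Q' : selfadjoint X) (N : R) :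
  `|w' - w| <= N -> `|Q' - Q| <= N -> N <= 1 ->
  `|quadform Q' (w'.1.1 - w'.1.2) - quadform Q (w.1.1 - w.1.2)
    - dot (quad_grad Q w) (w' - w)
    - dot (w.1.1 - w.1.2) (vsval (Q' - Q) (w.1.1 - w.1.2))| <=
  hom_const X * (4 * `|Q| + 4 * `|w.1.1 - w.1.2| + 4) * N * N.
Proof.
move=> wN QN N1; have C0 := @hom_const_gt0 R X.
have N0 : 0 <= N by apply: le_trans wN.
rewrite dot_quad_grad; set d := w.1.1 - w.1.2; set d' := w'.1.1 - w'.1.2.
have -> : (w' - w).1.1 - (w' - w).1.2 = d' - d.
  by apply: dot_inj => y; rewrite /= !(dotDr, dotNr); ring.
have dN : `|d' - d| <= 2 * N by apply: le_trans (norm_gap_le _ _) _; rewrite ler_pM2l.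
apply: le_trans (quadform_expansion Q Q' d d') _; rewrite -!mulrA ler_pM2l//.
have d2 : `|d' - d| ^+ 2 <= 4 * (N * N).
  by have := ler_pM (normr_ge0 _) (normr_ge0 _) dN dN; rewrite expr2; lra.
have t1 := ler_wpM2l (normr_ge0 Q) d2.
have t2 : `|Q' - Q| * `|d| * `|d' - d| <= N * `|d| * (2 * N).
  by rewrite ler_pM ?mulr_ge0// ler_wpM2r.
have t3 : `|Q' - Q| * `|d' - d| ^+ 2 <= 1 * (4 * (N * N)).
  by rewrite ler_pM ?exprn_ge0//; exact: le_trans N1.
lra.
Qed.

(** The quadratic term is smooth, and the indicator only increases the function
    around a point where it vanishes. *)
Lemma Xi_regular_of_Xi_tilde w Q v (W : selfadjoint X) : semidefinite Q ->
  (forall P : selfadjoint X, dot W P = dot (w.1.1 - w.1.2) (vsval P (w.1.1 - w.1.2))) ->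
  regular_subdiff Xit w v ->
  regular_subdiff XiQ ((w, Q) : S) ((v + quad_grad Q w, W) : S).
Proof.
move=> SQ WP [wf wv].
have cQ : chi (@semidefinite R X) Q = 0%E by rewrite /chi mem_set.
split; first by rewrite XiE cQ adde0 fin_numD wf.
move=> e e0; have e2 : 0 < e / 2 by rewrite divr_gt0.
pose K := hom_const X * (4 * `|Q| + 4 * `|w.1.1 - w.1.2| + 4).
have K0 : 0 < K by rewrite mulr_gt0 ?hom_const_gt0// ltr_wpDl// addr_ge0// mulr_ge0.
have [d1 d10 d1P] := near_distP (wv _ e2).
pose r := Num.min 1 (Num.min d1 (e / 2 / K)).
have r0 : 0 < r by rewrite !lt_min ltr01 d10 divr_gt0.
apply: filterS (near_dist ((w, Q) : S) r0) => -[w' Q'].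
set N := `|_ - _|; rewrite !lt_min => /and3P[N1 Nd NK].
have wN : `|w' - w| <= N by exact: (norm_fst_le ((w', Q') - (w, Q) : S)).
have QN : `|Q' - Q| <= N by exact: (norm_snd_le ((w', Q') - (w, Q) : S)).
have := d1P w' (le_lt_trans wN Nd).
have rem := quad_remainder_le wN QN (ltW N1).
rewrite -/K ler_norml in rem; case/andP: rem => rem _.
rewrite ltr_pdivlMr// in NK.
have N0 : 0 <= N by exact: normr_ge0.
have KN := ler_wpM2r N0 (ltW NK).
rewrite -/XiQ !XiE cQ adde0 => main.
apply: le_trans (_ : _ <= Xit w' + (quadform Q' (w'.1.1 - w'.1.2))%:E)%E _; last first.
  by rewrite leeDl// chi_ge0.
move: main; rewrite -(fineK wf).
case: (Xit w') => [t| |]; last 2 first.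
- by move=> _; rewrite leey.
- by rewrite -EFinD leeNy_eq.
rewrite -!EFinD !lee_fin => main.
have -> : dot ((v + quad_grad Q w, W) : S) ((w', Q') - (w, Q) : S) =
    dot v (w' - w) + dot (quad_grad Q w) (w' - w) + dot W (Q' - Q).
  by rewrite -dotDl.
rewrite WP.
have := ler_wpM2l (ltW e2) wN; lra.
Qed.

(** It suffices to move [w] with [Q] fixed, since the quadratic term is then smooth
    and the indicator constant. *)
Lemma Xi_tilde_regular_of_Xi w Q V :
  (forall y, -oo < Xit y)%E ->
  regular_subdiff XiQ ((w, Q) : S) V ->
  semidefinite Q /\ regular_subdiff Xit w (V.1 - quad_grad Q w).
Proof.
move=> XN [wf wV].
have [wf' SQ] : Xit w \is a fin_num /\ semidefinite Q.
  move: wf; rewrite XiE !fin_numD => /andP[/andP[-> _]]; split=> //.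
  by move: b; rewrite /chi; case: ifPn => //; rewrite inE.
split=> //; split=> // e e0.
have cQ : chi (@semidefinite R X) Q = 0%E by rewrite /chi mem_set.
have e2 : 0 < e / 2 by rewrite divr_gt0.
pose K := hom_const X * (4 * `|Q| + 4 * `|w.1.1 - w.1.2| + 4).
have K0 : 0 < K by rewrite mulr_gt0 ?hom_const_gt0// ltr_wpDl// addr_ge0// mulr_ge0.
have [d1 d10 d1P] := near_distP (wV _ e2).
pose r := Num.min 1 (Num.min d1 (e / 2 / K)).
have r0 : 0 < r by rewrite !lt_min ltr01 d10 divr_gt0.
apply: filterS (near_dist w r0) => w'.
rewrite !lt_min => /and3P[N1 Nd NK].
have nw : `|((w', Q) : S) - ((w, Q) : S)| <= `|w' - w|.
  by apply: le_trans (norm_eprod_le _) _; rewrite /= subrr normr0 addr0.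
have := d1P (w', Q) (le_lt_trans nw Nd).
have QQ : `|Q - Q| <= `|w' - w| by rewrite subrr normr0.
have := quad_remainder_le (lexx _) QQ (ltW N1).
rewrite -/K subrr !linear0 zero_lfunE dot0r subr0 ler_norml => /andP[_ rem].
rewrite ltr_pdivlMr// in NK.
have KN := ler_wpM2r (normr_ge0 (w' - w)) (ltW NK).
rewrite -/XiQ !XiE cQ !adde0.
have := XN w'; rewrite -(fineK wf').
case: (Xit w') => [t _| |//]; last by move=> _ _; rewrite leey.
rewrite -!EFinD !lee_fin => main.
have VE : dot V (((w', Q) : S) - ((w, Q) : S)) = dot V.1 (w' - w).
  by rewrite [LHS](_ : _ = dot V.1 (w' - w) + dot V.2 (Q - Q))// subrr dot0r addr0.
rewrite VE in main; rewrite dotBl.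
have := ler_wpM2l (ltW e2) nw; lra.
Qed.

Lemma Xi_lsc_at w Q : (forall y, -oo < Xit y)%E -> lsc_at Xit w ->
  lsc_at XiQ ((w, Q) : S).
Proof.
move=> XN lX.
have c0 : id t @[t --> ((w, Q) : S)] --> ((w, Q) : S) by exact: cvg_id.
have c1 : t.1 @[t --> ((w, Q) : S)] --> w by exact: (cvg_fst_eprod c0).
have c2 : t.2 @[t --> ((w, Q) : S)] --> Q by exact: (cvg_snd_eprod c0).
have c11 : t.1.1 @[t --> ((w, Q) : S)] --> w.1 by exact: (cvg_fst_eprod c1).
have c111 : t.1.1.1 @[t --> ((w, Q) : S)] --> w.1.1 by exact: (cvg_fst_eprod c11).
have c112 : t.1.1.2 @[t --> ((w, Q) : S)] --> w.1.2 by exact: (cvg_snd_eprod c11).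
pose q (t : S) : R := quadform t.2 (t.1.1.1 - t.1.1.2).
have -> : XiQ = (fun t => (Xit \o fst) t + (EFin \o q) t
    + (chi (@semidefinite R X) \o snd) t)%E.
  by apply/funext => -[[[x s] z] P].
apply: lsc_at_add.
- by rewrite /=; have := XN w; case: (Xit w) => //= *; exact: ltNyr.
- by apply: lt_le_trans (chi_ge0 _ _); exact: ltNyr.
- apply: lsc_at_add; [exact: XN|exact: ltNyr|by apply: lsc_at_comp|].
  apply: lsc_at_EFin; apply: cvg_quadform c2 _; exact: cvgB.
- by apply: lsc_at_comp; [exact: c2|exact: chi_semidefinite_lsc].
Qed.

End Xi.

(** * The KL property with the quadratic term *)

Section QualifiedQuadratic.
Context {R : realType} {X Y Z : euclideanType R}.
Variables (F : X -> Y) (G : X -> Z) (theta1 : Y -> R) (theta2 : Z -> R).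
Variables (h : X -> \bar R) (O : set X).
Hypothesis assumptions : standing_assumptions F G theta1 theta2 h O.
Variables (xbar : X) (zbar : Z).
Hypothesis critical : subdiff (Xi_tilde F G theta1 theta2 h) (xbar, xbar, zbar) 0.

Let Xit := Xi_tilde F G theta1 theta2 h.
Let XiQ := Xi F G theta1 theta2 h.
Let S := eprod (eprod (eprod X X) Z) (selfadjoint X).
Let wbar : eprod (eprod X X) Z := triple xbar xbar zbar.

Lemma cvg_pair_eprod (T : Type) (Fi : set_system T) {FF : Filter Fi}
    (U V : euclideanType R) (uk : T -> U) (vk : T -> V) u v :
  uk @ Fi --> u -> vk @ Fi --> v ->
  ((uk t, vk t) : eprod U V) @[t --> Fi] --> ((u, v) : eprod U V).
Proof.
move=> /cvgrPdist_lt cu /cvgrPdist_lt cv; apply/cvgrPdist_lt => e e0.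
have e2 : 0 < e / 2 by rewrite divr_gt0.
apply: filterS2 (cu _ e2) (cv _ e2) => t ut vt.
apply: le_lt_trans (norm_eprod_le _) _.
by rewrite [e]splitr; exact: ltrD.
Qed.

Lemma positive_definite_semidefinite (Q : selfadjoint X) :
  positive_definite Q -> semidefinite Q.
Proof.
move=> pd d; have [->|/pd/ltW//] := eqVneq d 0.
by rewrite /quadform dot0l.
Qed.

Lemma Xi_bar Q : semidefinite Q -> XiQ ((wbar, Q) : S) = Xit wbar.
Proof.
move=> SQ; rewrite /XiQ XiE /chi mem_set//= subrr /quadform dot0l.
by rewrite !adde0.
Qed.

(** The points and subgradients that witness that [0] is a limiting subgradient of
    [Xi_tilde] also serve here, with [Q] kept constant: the gradients of the quadratic
    term tend to [0] with [x - s]. *)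
Lemma subdiff_Xi_bar Q : semidefinite Q -> subdiff XiQ ((wbar, Q) : S) !=set0.
Proof.
move=> SQ; have [wf [wk [vk [[cw cX] reg cv]]]] := critical.
have cw11 : (wk n).1.1 @[n --> \oo] --> xbar.
  by have := cvg_fst_eprod (cvg_fst_eprod cw); apply.
have cw12 : (wk n).1.2 @[n --> \oo] --> xbar.
  by have := cvg_snd_eprod (cvg_fst_eprod cw); apply.
have cd : (wk n).1.1 - (wk n).1.2 @[n --> \oo] --> (0 : X).
  by rewrite -(subrr xbar); exact: cvgB.
have [W WP] := choice (fun n => riesz_quadform ((wk n).1.1 - (wk n).1.2)).
have cW : W @ \oo --> (0 : selfadjoint X).
  apply: norm_cvg0; apply: (@squeeze_cvgr _ _ _ _ (fun=> 0)
     (fun n => hom_const X * `|(wk n).1.1 - (wk n).1.2| ^+ 2)).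
  - by apply: nearW => n; rewrite normr_ge0/=; have [] := WP n.
  - exact: cvg_cst.
  have -> : (0 : R) = hom_const X * (`|0 : X| * `|0 : X|) by rewrite normr0 !mulr0.
  apply: cvgM; first exact: cvg_cst.
  by apply: cvgM; exact: cvg_norm cd.
have cg : quad_grad Q (wk n) @[n --> \oo] --> (0 : eprod (eprod X X) Z).
  apply: norm_cvg0; apply: (@squeeze_cvgr _ _ _ _ (fun=> 0)
     (fun n => 4 * (hom_const X * `|Q| * `|(wk n).1.1 - (wk n).1.2|))).
  - apply: nearW => n; rewrite normr_ge0/=.
    apply: le_trans (norm_quad_grad_le _ _) _; rewrite ler_pM2l//.
    exact: norm_selfadjoint_le.
  - exact: cvg_cst.
  have -> : (0 : R) = 4 * (hom_const X * `|Q| * `|0 : X|) by rewrite normr0 !mulr0.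
  apply: cvgM; first exact: cvg_cst.
  by apply: cvgM; [exact: cvg_cst|exact: cvg_norm cd].
exists 0; split; first by rewrite Xi_bar.
exists (fun n => (wk n, Q)), (fun n => (vk n + quad_grad Q (wk n), W n)); split.
- split; first by apply: cvg_pair_eprod => //; exact: cvg_cst.
  rewrite Xi_bar//.
  have -> : XiQ \o (fun n => (wk n, Q) : S) =
     fun n => (Xit (wk n) + (quadform Q ((wk n).1.1 - (wk n).1.2))%:E)%E.
    by apply/funext => n; rewrite [LHS]XiE /chi mem_set//= adde0.
  rewrite -[Xit wbar]adde0; apply: cvgeD => //.
    exact: fin_num_adde_defl.
  apply: cvg_EFin; first exact: nearW.
  have -> : (0 : R) = quadform Q 0 by rewrite /quadform dot0l.
  by apply: cvg_quadform cd; exact: cvg_cst.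
- by move=> n; apply: Xi_regular_of_Xi_tilde => //; have [] := WP n.
- apply: cvg_pair_eprod => //.
  by rewrite -[X in _ --> X]addr0; exact: cvgD.
Qed.

Hypothesis C1F' : C1_near xbar (fderiv F).
Hypothesis C1G' : C1_near xbar (fderiv G).
Variables (p : R).
Hypothesis p01 : 0 <= p < 1.
Hypothesis KLf : KL_property setT (f_sep theta1 theta2 h) p
             (F xbar, xbar, G xbar, zbar).
Hypothesis qualification :
       grad_kernel F G xbar `&` limsup_cone F G theta1 theta2 h xbar
       = [set (0, 0, 0)].

(** This is where [1 / 2 <= p] enters: a gap [g] dominated by the square of [N] has
    [g^p <= g^(1/2)] dominated by [N]. *)
Lemma powR_gap_le (g q K N : R) : 1 / 2 <= p -> 0 < g <= 1 -> 0 <= N -> 1 <= K ->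
  g / 2 <= q -> q <= K * N ^+ 2 -> g `^ p <= 2 * K * N.
Proof.
move=> p2 /andP[g0 g1] N0 K1 gq qN.
have gE : g `^ p <= g `^ (1 / 2) by apply: ger_powR => //; rewrite g0.
apply: le_trans gE _; rewrite div1r powR12_sqrt; last exact: ltW.
have KN : 0 <= 2 * K * N by rewrite !mulr_ge0//; lra.
rewrite -(@ler_pXn2r _ 2)// ?nnegrE ?sqrtr_ge0//.
rewrite sqr_sqrtr; last exact: ltW.
rewrite !exprMn.
apply: le_trans (_ : 2 * (K * N ^+ 2) <= _); first by lra.
rewrite mulrA ler_wpM2r ?exprn_ge0//.
have := ler_wpM2l (le_trans ler01 K1) K1; rewrite !expr2; lra.
Qed.

(** Write [d = x - s]. The [(x, s, z)]-part of a regular subgradient [V] of [Xi] is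
    [v + (2 Q d, - 2 Q d, 0)], with [v] a regular subgradient of [Xi_tilde]. As the
    [s]-component of [v] is at most [M `|d|] times its [x]-component, the [s]-component of
    [V] cannot be small unless [Q d] is: this gives [`|Q d| <= 3 / 2 `|V|], hence
    [`|d| <= C `|V|] by coercivity and [`|v| <= 7 `|V|]. The value gap of [Xi] is that of
    [Xi_tilde] plus the quadratic term. If the latter is at least half of the gap, then
    [powR_gap_le] applies; otherwise the gap is at most twice that of [Xi_tilde]. *)
Lemma KL_property_Xi Q : 1 / 2 <= p -> positive_definite Q ->
  KL_property [set w : S | O w.1.1.2] XiQ p ((wbar, Q) : S).
Proof.
move=> p2 pd; have SQ := positive_definite_semidefinite pd.
have [c [eta [del [M [c0 eta0 del0 M0 est]]]]] :=
  local_estimate assumptions critical C1F' C1G' p01 KLf qualification.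
have [k k0 kP] := positive_definite_coercive pd.
have wf := Xi_tilde_bar_fin critical.
(* [9 / 4] is the square of the constant [3 / 2] in the bound on [Q d]; in the
   second bound, [14 = 2 * 7]. *)
pose K := k * (9 / 4) + 1.
have K1 : 1 <= K by rewrite /K lerDr; lra.
pose c' := Num.min (2 * K)^-1 (c / 14).
have c'0 : 0 < c' by rewrite lt_min invr_gt0 divr_gt0//; lra.
pose eta' := Num.min 1 eta.
have eta'0 : 0 < eta' by rewrite lt_min ltr01.
pose del' := del / 2.
have del'0 : 0 < del' by rewrite divr_gt0.
have c0' : id t @[t --> ((wbar, Q) : S)] --> ((wbar, Q) : S) by exact: cvg_id.
have cw : t.1 @[t --> ((wbar, Q) : S)] --> wbar by exact: (cvg_fst_eprod c0').
have cQ : t.2 @[t --> ((wbar, Q) : S)] --> Q by exact: (cvg_snd_eprod c0').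
have cw1 : t.1.1 @[t --> ((wbar, Q) : S)] --> wbar.1 by exact: (cvg_fst_eprod cw).
have cx : t.1.1.1 @[t --> ((wbar, Q) : S)] --> xbar by exact: (cvg_fst_eprod cw1).
have cs : t.1.1.2 @[t --> ((wbar, Q) : S)] --> xbar by exact: (cvg_snd_eprod cw1).
have cd : t.1.1.1 - t.1.1.2 @[t --> ((wbar, Q) : S)] --> (0 : X).
  by rewrite -(subrr xbar); exact: (cvgB cx cs).
have cQd : vsval (t.2 : selfadjoint X) (t.1.1.1 - t.1.1.2)
    @[t --> ((wbar, Q) : S)] --> (0 : X).
  by rewrite -(linear0 (vsval Q)); exact: (cvg_selfadjoint_apply cQ cd).
have r1 : 0 < (2 * M)^-1 by rewrite invr_gt0 mulr_gt0.
have r2 : 0 < del / 8 by rewrite divr_gt0.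
have near_d : \forall t \near ((wbar, Q) : S), `|t.1.1.1 - t.1.1.2| <= (2 * M)^-1.
  by near=> t; rewrite -[X in `|X|]subr0; near: t; exact: (cvgr_distC_le _ _ cd _ r1).
have near_Qd : \forall t \near ((wbar, Q) : S),
    `|vsval (t.2 : selfadjoint X) (t.1.1.1 - t.1.1.2)| <= del / 8.
  by near=> t; rewrite -[X in `|X|]subr0; near: t; exact: (cvgr_distC_le _ _ cQd _ r2).
apply: (@KL_of_small_subgradients _ _ p01 _ _ _ _ c' eta' del') => //.
- split.
    move=> [w P] _; rewrite /XiQ XiE.
    have := Xi_tilde_gtNy assumptions w; have := chi_ge0 (@semidefinite R X) P.
    by case: (chi _ _) => //= [r _|_]; case: (Xi_tilde _ _ _ _ _ _) => //= *; rewrite ?ltNyr.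
  exists (wbar, Q); first exact: (O_xbar assumptions critical).
  have -> : edom XiQ ((wbar, Q) : S) = (XiQ ((wbar, Q) : S) < +oo)%E by [].
  by rewrite Xi_bar// ltey; move: wf; rewrite fin_numE => /andP[].
- apply: lsc_on_open => -[w P] Ow; apply: Xi_lsc_at.
    exact: Xi_tilde_gtNy assumptions.
  exact: (Xi_tilde_lsc_at assumptions (w := w) Ow).
- exact: (O_xbar assumptions critical).
- exact: subdiff_Xi_bar.
rewrite Xi_bar//; set a := fine (Xit wbar).
near=> t => b V.
have estw : forall v, `|v| < del -> regular_subdiff Xit t.1 v ->
    (forall b, Xit t.1 = b%:E -> 0 < b - fine (Xit wbar) < eta ->
       c * (b - fine (Xit wbar)) `^ p <= `|v|) /\
    `|v.1.2| <= M * `|t.1.1.1 - t.1.1.2| * `|v.1.1|.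
  by near: t; exact: cw _ est.
have kt : forall d, `|d| <= k * `|vsval (t.2 : selfadjoint X) d|.
  by near: t; exact: cQ _ kP.
have dM : `|t.1.1.1 - t.1.1.2| <= (2 * M)^-1.
  by near: t; exact: near_d.
have Qd_small : `|vsval (t.2 : selfadjoint X) (t.1.1.1 - t.1.1.2)| <= del / 8.
  by near: t; exact: near_Qd.
move: estw kt dM Qd_small.
set w := t.1; set P := t.2; set d := w.1.1 - w.1.2; set N := `|V|.
have tE : t = ((w, P) : S) by rewrite /w /P; case: (t).
move=> estw /(_ d) dk dM Qd_small; rewrite tE => tb /andP[b0 b1] Vdel.
move=> /Xi_tilde_regular_of_Xi - /(_ (Xi_tilde_gtNy assumptions)).
move=> [SP]; set v := _ - _ => vreg.
have V1N : `|V.1| <= N := norm_fst_le V.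
have vV : `|v| <= `|V.1| + 4 * `|vsval P d|.
  by apply: le_trans (ler_normB _ _) _; rewrite lerD2l; exact: norm_quad_grad_le.
have vdel : `|v| < del by move: Vdel; rewrite /del' -/N; lra.
have [KLv vs] := estw v vdel vreg.
have Md : M * `|d| <= 2^-1.
  have := ler_wpM2l (ltW M0) dM; rewrite invfM mulrCA mulfV ?mulr1//.
  by rewrite gt_eqF.
have QdN : `|vsval P d| <= 3 / 2 * N.
  have V12 : `|V.1.1.2| <= N.
    exact: le_trans (norm_snd_le V.1.1) (le_trans (norm_fst_le V.1) V1N).
  have V11 : `|V.1.1.1| <= N.
    exact: le_trans (norm_fst_le V.1.1) (le_trans (norm_fst_le V.1) V1N).
  have v11 : `|v.1.1| <= N + 2 * `|vsval P d|.
    rewrite /v /=; apply: le_trans (ler_normB _ _) _.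
    by rewrite normrZ ger0_norm// lerD2r.
  have e12 : 2 * `|vsval P d| <= N + `|v.1.2|.
    have -> : 2 * `|vsval P d| = `|v.1.2 - V.1.1.2|.
      rewrite /v /= opprK addrAC subrr add0r normrZ ger0_norm//.
    by apply: le_trans (ler_normB _ _) _; rewrite addrC lerD2r.
  have m1 : M * `|d| * `|v.1.1| <= 2^-1 * (N + 2 * `|vsval P d|).
    by apply: ler_pM => //; rewrite mulr_ge0// ltW.
  by move: vs; rewrite -/d; lra.
have [b' Xb'] : exists b', Xit w = b'%:E.
  by exists (fine (Xit w)); rewrite fineK//; have [] := vreg.
pose q := quadform P d.
have bq : b = b' + q.
  move: tb; rewrite /XiQ [LHS]XiE -/Xit Xb' /chi mem_set// adde0 -EFinD => -[<-].
  by [].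
have q0 : 0 <= q by exact: SP.
have N0 : 0 <= N by exact: normr_ge0.
have qN : q <= K * N ^+ 2.
  apply: le_trans (dot_le _ _) _.
  apply: le_trans (ler_wpM2r (normr_ge0 _) dk) _.
  have := ler_pM (normr_ge0 _) (normr_ge0 _) QdN QdN.
  move=> /(ler_wpM2l (ltW k0)) QQ.
  have : 0 <= N ^+ 2 by rewrite exprn_ge0.
  by rewrite /K; rewrite expr2; lra.
move: b1; rewrite lt_min => /andP[b1 beta].
have g01 : 0 < b - a <= 1 by rewrite b0 ltW.
have gp0 : 0 <= (b - a) `^ p := powR_ge0 _ _.
have [gq|gq] := leP ((b - a) / 2) q.
  have gN := powR_gap_le p2 g01 N0 K1 gq qN.
  have K2 : 0 < 2 * K by lra.
  apply: le_trans (_ : (2 * K)^-1 * (b - a) `^ p <= _).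
    by rewrite ler_wpM2r// /c' ge_min lexx.
  by rewrite mulrC ler_pdivrMr// mulrC.
have gb' : 0 < b' - fine (Xit wbar) < eta by rewrite -/a; apply/andP; split; lra.
have := KLv b' Xb' gb'; rewrite -/a => KLb.
have p_bounds := andP p01.
have pow2 : (b - a) `^ p <= 2 * (b' - a) `^ p.
  have b'a : 0 <= b' - a by lra.
  apply: le_trans (_ : (2 * (b' - a)) `^ p <= _).
    apply: ge0_ler_powR; rewrite ?nnegrE; [by case: p_bounds|lra|lra|lra].
  rewrite powRM// ler_wpM2r ?powR_ge0//.
  by apply: ler1_powR; [lra|case: p_bounds => _ /ltW].
apply: le_trans (_ : c / 14 * (b - a) `^ p <= _).
  by rewrite ler_wpM2r// /c' ge_min lexx orbT.
have := ler_wpM2l (ltW c0) pow2; lra.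
Unshelve. all: by end_near. Qed.

End QualifiedQuadratic.

Theorem proposition4p4 (R : realType) (X Y Z : euclideanType R)
    (F : X -> Y) (G : X -> Z) (theta1 : Y -> R) (theta2 : Z -> R)
    (h : X -> \bar R) (O : set X)
    (assumptions : standing_assumptions F G theta1 theta2 h O)
    (xbar : X) (zbar : Z)
    (critical : subdiff (Xi_tilde F G theta1 theta2 h) (xbar, xbar, zbar) 0)
    (C1F' : C1_near xbar (fderiv F)) (C1G' : C1_near xbar (fderiv G))
    (p : R) (p01 : 0 <= p < 1)
    (KLf : KL_property setT (f_sep theta1 theta2 h) p
             (F xbar, xbar, G xbar, zbar))
    (qualification :
       grad_kernel F G xbar `&` limsup_cone F G theta1 theta2 h xbar
       = [set (0, 0, 0)]) :
  KL_property [set w : eprod (eprod X X) Z | O w.1.2] (Xi_tilde F G theta1 theta2 h) p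
    (xbar, xbar, zbar) /\
  (1 / 2 <= p -> forall Q : selfadjoint X, positive_definite Q ->
     KL_property
       [set w : eprod (eprod (eprod X X) Z) (selfadjoint X) | O w.1.1.2]
       (Xi F G theta1 theta2 h) p
       (xbar, xbar, zbar, Q)).
Proof.
split.
  exact: (KL_property_Xi_tilde assumptions critical C1F' C1G' p01 KLf qualification).
move=> p2 Q pd.
exact: (KL_property_Xi assumptions critical C1F' C1G' p01 KLf qualification p2 pd).
Qed.
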